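(* For every integer $k\ge 3$, the $k$-total cut complex of the squared cycle graph $W_{3k+2}$ is homotopy equivalent to the $5$-sphere: $\Delta_k^t(W_{3k+2})\simeq \mathbb{S}^5$.
   Context: The squared cycle graph $W_n$ is the graph with vertex set $[n]=\{1,\dots,n\}$ and edge set $\{\{i,i+1 \bmod n\},\{i,i+2 \bmod n\} : i=1,\dots,n\}$. For a graph $G=(V,E)$ and $k\ge 1$, the $k$-total cut complex $\Delta_k^t(G)$ is the simplicial complex on $V$ whose facets are the complements $V\setminus S$ of independent sets $S$ of $G$ with $|S|=k$; equivalently, $\sigma\subseteq V$ is a face iff $V\setminus\sigma$ contains an independent set of size $k$. *)

(* Defs.v *)
From HB Require Import structures.
From mathcomp Require Import all_boot all_order all_algebra.
From mathcomp Require Import all_classical all_reals topology normedtype.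
Set Implicit Arguments. Unset Strict Implicit. Unset Printing Implicit Defensive.
Import Order.TTheory GRing.Theory Num.Theory.

Import numFieldNormedType.Exports.
Local Open Scope classical_set_scope.
Local Open Scope ring_scope.

(* Squared cycle graph W_n on vertex set 'I_n = {0,...,n-1}
   (vertex i here corresponds to vertex i+1 of the paper):
   i ~ j iff j = i+1 mod n, j = i+2 mod n, or symmetrically. *)
Definition sqcycle_adj (n : nat) (i j : 'I_n) : bool :=
  [|| (val j == (val i + 1) %% n)%N, (val i == (val j + 1) %% n)%N,
      (val j == (val i + 2) %% n)%N | (val i == (val j + 2) %% n)%N].

Definition independent (T : finType) (adj : rel T) (S : {set T}) : bool :=
  [forall x in S, forall y in S, (x != y) ==> ~~ adj x y].

Definition total_cut_face (T : finType) (adj : rel T) (k : nat)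
    (sigma : {set T}) : bool :=
  [exists S : {set T}, [&& independent adj S, #|S| == k & S \subset ~: sigma]].

(* Geometric realization of a simplicial complex on vertex set 'I_n (given by
   its face predicate) inside R^n, as the union of the closed simplices
   conv{e_i : i in sigma} for faces sigma (standard barycentric model). *)
Definition realization (R : realType) (n : nat) (face : pred {set 'I_n})
    : set 'rV[R]_n :=
  [set x | (forall i, 0 <= x ord0 i) /\ \sum_i x ord0 i = 1 /\
           face [set i | x ord0 i != 0]%SET].

Definition sphere (R : realType) (d : nat) : set 'rV[R]_d.+1 :=
  [set y | \sum_i (y ord0 i) ^+ 2 = 1].

Definition homotopic_on (R : realType) (T U : topologicalType)
    (A : set T) (B : set U) (f g : T -> U) : Prop :=
  exists H : R * T -> U,
    {within (`[0, 1] `*` A : set (R * T)), continuous H} /\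
    (forall t x, (`[0, 1]%classic : set R) t -> A x -> B (H (t, x))) /\
    (forall x, A x -> H (0, x) = f x /\ H (1, x) = g x).

Definition homotopy_equivalent (R : realType) (T U : topologicalType)
    (A : set T) (B : set U) : Prop :=
  exists (f : T -> U) (g : U -> T),
    [/\ {within A, continuous f}, f @` A `<=` B,
        {within B, continuous g} & g @` B `<=` A] /\
    homotopic_on R A A (g \o f) id /\ homotopic_on R B B (f \o g) id.

Arguments realization R {n} face _.
Arguments sphere : clear implicits.
Arguments homotopic_on R {T U} A B f g.
Arguments homotopy_equivalent R {T U} A B.

(* Main.v *)
Require Import Defs.
From HB Require Import structures.
From mathcomp Require Import all_boot all_order all_algebra.
From mathcomp Require Import all_classical all_reals topology normedtype.
From mathcomp Require Import realfun lra zify.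
Import numFieldNormedType.Exports.
Set Implicit Arguments. Unset Strict Implicit. Unset Printing Implicit Defensive.
Import Order.TTheory GRing.Theory Num.Theory.
Local Open Scope classical_set_scope.
Local Open Scope ring_scope.

(* Dividing by 3 modulo n = 3k + 2 turns the independent k-sets of the squared
   cycle into the complements of two disjoint arcs of k + 1 vertices of Z/n, so
   that the complex consists of the sets covered by two arcs of k steps.

   Removing from a complex a family of faces that is stable under adding and
   deleting one fixed vertex preserves the homotopy type.  For k >= 3, four such
   collapses show that one arc may be lengthened by one step.  Once the arc at 0
   is lengthened, three vertices are successively dominated by their
   predecessors, and deleting them leaves the complex of Z/(3(k - 1) + 2) with
   arcs of k - 1 steps, the arcs at 0 and 1 being lengthened.  Shortening the arc
   at 0 again and rotating, one descends to k = 2, where deleting one more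
   dominated vertex leaves the boundary of the 6-simplex. *)

(** When all arcs have k steps, every facet has 2k + 2 vertices and no vertex is dominated, so no
    deletion can start. One longer arc breaks the symmetry: the arc at 1 then lies inside the arc
    from 0 to k + 1, so that 0 dominates 1. Once 1 is gone, the arc that ends at 1 lies inside its
    shift by one step back, so its first vertex is dominated in turn, and the effect propagates
    backwards around the cycle, k steps at a time.

    Lengthening is not one collapse: 1 is the natural apex, but it fails for the faces that need the
    long arc only because they contain 1, and these require three further apexes. The lengthening is
    proved with the arc at 1 either short or long, since the descent starts with the former and
    continues with the latter.

    The dimension 5 appears only at the end: for k = 2 the last deletion leaves a cycle of seven
    vertices with arcs of three, and two such arcs cover all vertices but one. *)

(** * Continuity into row vectors and on subsets *)

Lemma cvg_rowP (T : Type) (R : topologicalType) (n : nat) (F : set_system T)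
    {FF : Filter F} (f : T -> 'rV[R]_n) (M : 'rV[R]_n) :
  (forall j, (fun x => f x ord0 j) @ F --> M ord0 j) -> f @ F --> M.
Proof.
move=> cf A [P nP sPA].
suff : \forall x \near F, forall j, P ord0 j (f x ord0 j).
  by apply: filterS => x Px; apply: sPA => i j; rewrite (ord1 i).
by apply: filter_forall => j; exact: (cf j _ (nP ord0 j)).
Qed.

Lemma continuous_row (T U : topologicalType) (n : nat) (f : T -> 'rV[U]_n) :
  (forall j, continuous (fun x => f x ord0 j)) -> continuous f.
Proof. by move=> cf x; apply: (@cvg_rowP _ _ _ (nbhs x)) => j; exact: cf. Qed.

Lemma within_continuous_comp (T U V : topologicalType) (A : set T) (B : set U)
    (f : T -> U) (g : U -> V) :
  {within A, continuous f} -> {within B, continuous g} -> f @` A `<=` B ->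
  {within A, continuous (g \o f)}.
Proof.
move=> /subspace_continuousP cf /subspace_continuousP cg fAB.
apply/subspace_continuousP => x Ax W nW.
have Bfx : B (f x) by apply: fAB; exists x.
have := cf x Ax _ (cg _ Bfx _ nW).
rewrite /= /nbhs /= /within /=; apply: filterS => y Wy Ay.
by apply: Wy => //; apply: fAB; exists y.
Qed.

Lemma within_continuous_pair (T U V : topologicalType) (A : set T)
    (f : T -> U) (g : T -> V) :
  {within A, continuous f} -> {within A, continuous g} ->
  {within A, continuous (fun x => (f x, g x))}.
Proof.
move=> /subspace_continuousP cf /subspace_continuousP cg.
by apply/subspace_continuousP => x Ax; apply: cvg_pair; [exact: cf|exact: cg].
Qed.

(** * Homotopy equivalence of subsets of normed spaces *)

Section HomotopyEquivalence.
Context {R : realType}.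

Lemma homotopy_equivalent_sym (T U : topologicalType) (A : set T) (B : set U) :
  homotopy_equivalent R A B -> homotopy_equivalent R B A.
Proof. by move=> [f [g [[cf fA cg gB] [H1 H2]]]]; exists g, f. Qed.

Lemma homotopic_on_eq (T U : topologicalType) (A : set T) (B : set U)
    (f f' g g' : T -> U) :
  {in A, f =1 f'} -> {in A, g =1 g'} ->
  homotopic_on R A B f g -> homotopic_on R A B f' g'.
Proof.
move=> ff gg [H [cH [HB H01]]]; exists H; split=> //; split=> // x Ax.
by rewrite -ff ?inE// -gg ?inE//; exact: H01.
Qed.

Lemma homotopic_on_comp (T U V W : topologicalType) (A : set T) (B : set U)
    (C : set V) (D : set W) (f g : U -> V) (h : T -> U) (l : V -> W) :
  homotopic_on R B C f g ->
  {within A, continuous h} -> h @` A `<=` B ->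
  {within C, continuous l} -> l @` C `<=` D ->
  homotopic_on R A D (l \o f \o h) (l \o g \o h).
Proof.
move=> [H [cH [HC H01]]] ch hAB cl lCD.
exists (fun p => l (H (p.1, h p.2))); split; last split.
- have chs : {within `[0, 1] `*` A,
      continuous (fun p : R * T => (p.1, h p.2))}.
    apply: within_continuous_pair.
      by apply: continuous_subspaceT => p; exact: cvg_fst.
    apply: (@within_continuous_comp _ _ _ _ A snd h) => //.
      by apply: continuous_subspaceT => p; exact: cvg_snd.
    by move=> _ [p [_ Ap] <-].
  apply: (@within_continuous_comp _ _ _ _ C
    (H \o (fun p : R * T => (p.1, h p.2))) l) => //.
    apply: within_continuous_comp chs cH _.
    by move=> _ [p [p1 Ap] <-]; split=> //=; apply: hAB; exists p.2.
  move=> _ [p [p1 Ap] <-] /=; apply: HC => //.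
  by apply: hAB; exists p.2.
- move=> t x t01 Ax; apply: lCD; exists (H (t, h x)) => //.
  by apply: HC => //; apply: hAB; exists x.
- move=> x Ax /=; have Bh : B (h x) by apply: hAB; exists x.
  by have [-> ->] := H01 _ Bh.
Qed.

(* The two homotopies are run on [min 1 2t] and [max 0 (2t - 1)] and added,
   minus the common value in the middle; the vector space structure of the
   target replaces a pasting lemma. *)
Lemma homotopic_on_trans (T : topologicalType) (U : normedModType R)
    (A : set T) (B : set U) (f g h : T -> U) :
  homotopic_on R A B f g -> homotopic_on R A B g h -> homotopic_on R A B f h.
Proof.
move=> [F [cF [FB F01]]] [G [cG [GB G01]]].
pose u (t : R) : R := Num.min 1 (2 * t); pose v (t : R) : R := Num.max 0 (2 * t - 1).
have u01 (t : R) : `[0, 1]%classic t -> `[0, 1]%classic (u t).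
  rewrite /= !in_itv/= /u => /andP[t0 t1]; rewrite ge_min lexx le_min; lra.
have v01 (t : R) : `[0, 1]%classic t -> `[0, 1]%classic (v t).
  rewrite /= !in_itv/= /v => /andP[t0 t1]; rewrite le_max lexx ge_max; lra.
have c2 : continuous (fun t : R => 2 * t).
  by move=> t; apply: cvgM; [exact: cvg_cst|exact: cvg_id].
have cu : continuous u.
  by apply: (@min_fun_continuous _ _ R (cst 1) _ _ c2) => t; exact: cvg_cst.
have cv : continuous v.
  apply: (@max_fun_continuous _ _ R (cst 0)) => t; first exact: cvg_cst.
  by apply: cvgB; [exact: c2|exact: cvg_cst].
have aux (w : R -> R) (K : R * T -> U) : continuous w ->
    (forall t : R, `[0, 1]%classic t -> `[0, 1]%classic (w t)) ->
    {within `[0, 1] `*` A, continuous K} ->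
    forall p : R * T, (`[0, 1] `*` A) p -> K (w q.1, q.2)
      @[q --> within (`[0, 1] `*` A) (nbhs p)] --> K (w p.1, p.2).
  move=> cw w01 cK.
  apply/(@subspace_continuousP _ _ _ (K \o (fun p : R * T => (w p.1, p.2)))).
  apply: (within_continuous_comp _ cK).
    apply: continuous_subspaceT => p.
    have c1 : (fun q : R * T => w q.1) @ nbhs p --> w p.1.
      by apply: (@cvg_comp _ _ _ fst w _ (nbhs p.1)); [exact: cvg_fst|exact: cw].
    have c2' : snd @ nbhs p --> p.2 by exact: cvg_snd.
    exact: cvg_pair c1 c2'.
  by move=> _ [p [p1 Ap] <-]; split=> //=; apply: w01.
have H0 : `[0, 1]%classic (0 : R) by rewrite /= in_itv/= lexx ler01.
have H1 : `[0, 1]%classic (1 : R) by rewrite /= in_itv/= lexx ler01.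
pose H p := F (u p.1, p.2) + G (v p.1, p.2) - G (0, p.2).
have Hl t x : A x -> t <= 1 / 2 -> H (t, x) = F (2 * t, x).
  move=> Ax th; rewrite /H /= /u /v.
  have -> : Num.min 1 (2 * t) = 2 * t by apply/min_idPr; lra.
  have -> : Num.max 0 (2 * t - 1) = 0 by apply/max_idPl; lra.
  by rewrite addrK.
have Hr t x : A x -> 1 / 2 <= t -> H (t, x) = G (2 * t - 1, x).
  move=> Ax th; rewrite /H /= /u /v.
  have -> : Num.min 1 (2 * t) = 1 by apply/min_idPl; lra.
  have -> : Num.max 0 (2 * t - 1) = 2 * t - 1 by apply/max_idPr; lra.
  have [_ ->] := F01 x Ax; have [-> _] := G01 x Ax.
  by rewrite addrC addrA [- _ + _]addrC subrr add0r.
exists H; split; last split.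
- have c1 := aux u F cu u01 cF.
  have c2' := aux v G cv v01 cG.
  have c3 := aux (fun=> 0) G (fun=> cvg_cst _) (fun _ _ => H0) cG.
  apply/subspace_continuousP => p Ap.
  by apply: cvgB; [apply: cvgD; [exact: c1|exact: c2']|exact: c3].
- move=> t x t01 Ax; have [th|/ltW th] := leP t (1 / 2).
    rewrite Hl//; apply: FB => //; move: t01; rewrite /= !in_itv/=; lra.
  rewrite Hr//; apply: GB => //; move: t01; rewrite /= !in_itv/=; lra.
- move=> x Ax; split.
    by rewrite Hl// ?mulr0; [have [] := F01 x Ax|lra].
  rewrite Hr//; last lra.
  by rewrite mulr1 (_ : 2 - 1 = 1); [have [] := G01 x Ax|lra].
Qed.

Lemma homotopy_equivalent_trans (T V : normedModType R) (U : topologicalType)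
    (A : set T) (B : set U) (C : set V) :
  homotopy_equivalent R A B -> homotopy_equivalent R B C ->
  homotopy_equivalent R A C.
Proof.
move=> [f [g [[cf fA cg gB] [gf fg]]]] [f' [g' [[cf' fB cg' gC] [gf' fg']]]].
exists (f' \o f), (g \o g'); split; [split|split].
- exact: within_continuous_comp fA.
- by move=> _ [x Ax <-]; apply: fB; exists (f x) => //; apply: fA; exists x.
- exact: within_continuous_comp gC.
- by move=> _ [x Ax <-]; apply: gB; exists (g' x) => //; apply: gC; exists x.
- apply: homotopic_on_trans gf.
  exact: (homotopic_on_comp gf' cf fA cg gB).
- apply: homotopic_on_trans fg'.
  exact: (homotopic_on_comp fg cg' gC cf' fB).
Qed.

(** The only source of homotopies: all others arise from straight-line ones by composition and
    concatenation. *)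
Lemma homotopic_on_segment (T : normedModType R) (A : set T) (f : T -> T) :
  {within A, continuous f} ->
  (forall (t : R) x, 0 <= t <= 1 -> A x -> A ((1 - t) *: f x + t *: x)) ->
  homotopic_on R A A f id.
Proof.
move=> cf Af; exists (fun p => (1 - p.1) *: f p.2 + p.1 *: p.2).
split; last split.
- have /subspace_continuousP cf2 : {within `[0, 1] `*` A,
      continuous (fun p : R * T => f p.2)}.
    apply: (@within_continuous_comp _ _ _ _ A snd f) => //.
      by apply: continuous_subspaceT => p; exact: cvg_snd.
    by move=> _ [p [_ Ap] <-].
  apply/subspace_continuousP => p Ap.
  have c1 : fst @ within (`[0, 1] `*` A) (nbhs p) --> p.1.
    by apply: cvg_within_filter; exact: cvg_fst.
  have c2 : snd @ within (`[0, 1] `*` A) (nbhs p) --> p.2.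
    by apply: cvg_within_filter; exact: cvg_snd.
  apply: cvgD; apply: cvgZ => //; last exact: cf2.
  by apply: cvgB => //; exact: cvg_cst.
- by move=> t x; rewrite /= in_itv/= => t01 Ax; exact: Af.
- by move=> x Ax /=; rewrite subr0 scale1r scale0r addr0 subrr scale0r scale1r add0r.
Qed.

Lemma homotopy_equivalent_of_inverse (T U : normedModType R) (A : set T)
    (B : set U) (f : T -> U) (g : U -> T) :
  {within A, continuous f} -> f @` A `<=` B ->
  {within B, continuous g} -> g @` B `<=` A ->
  {in A, cancel f g} -> {in B, cancel g f} -> homotopy_equivalent R A B.
Proof.
move=> cf fA cg gB fK gK; exists f, g; split; first by split.
have id_id (V : normedModType R) (C : set V) : homotopic_on R C C id id.
  apply: homotopic_on_segment; first by apply: continuous_subspaceT => ?; exact: cvg_id.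
  by move=> t x _ Cx; rewrite -scalerDl subrK scale1r.
split; apply: homotopic_on_eq (id_id _ _) => x Ax //=.
  by rewrite fK.
by rewrite gK.
Qed.

Lemma homotopy_equivalent_refl (T : normedModType R) (A : set T) :
  homotopy_equivalent R A A.
Proof.
by apply: (@homotopy_equivalent_of_inverse _ _ _ _ id id) => //;
  try (by apply: continuous_subspaceT => ?; exact: cvg_id);
  move=> _ [x Ax <-].
Qed.

Lemma homotopy_equivalent_retract (T : normedModType R) (A B : set T)
    (r : T -> T) :
  B `<=` A -> {within A, continuous r} -> r @` A `<=` B ->
  {in B, r =1 id} ->
  (forall (t : R) x, 0 <= t <= 1 -> A x -> A ((1 - t) *: r x + t *: x)) ->
  homotopy_equivalent R A B.
Proof.
move=> BA cr rA rB Ar; exists r, id; split; first split=> //.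
- by apply: continuous_subspaceT => ?; exact: cvg_id.
- by move=> _ [x Bx <-]; exact: BA.
split; first exact: homotopic_on_segment.
apply: homotopic_on_segment; first
  by apply: continuous_subspaceW BA _.
by move=> t x _ Bx; rewrite /= rB ?inE// -scalerDl subrK scale1r.
Qed.

End HomotopyEquivalence.

(** * Collapses of simplicial complexes *)

Lemma continuous_bigop (T U : topologicalType) (op : U -> U -> U) (I : Type)
    (s : seq I) (P : pred I) (f0 : T -> U) (f : I -> T -> U) :
  continuous (fun p => op p.1 p.2) ->
  continuous f0 -> (forall i, continuous (f i)) ->
  continuous (fun x => \big[op/f0 x]_(i <- s | P i) f i x).
Proof.
move=> cop c0 cf; elim: s => [|i s IHs]; first by under eq_fun do rewrite big_nil.
under eq_fun do rewrite big_cons.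
case: (P i) => // x.
exact: (@continuous2_cvg _ _ _ _ _ _ (f i) _ op _ _ (cop (_, _)) (cf i x) (IHs x)).
Qed.

Lemma bigmin_attained (R : realType) (I : finType) (P : pred I) (f : I -> R)
    (i0 : I) : P i0 ->
  exists2 i, P i & \big[Num.min/f i0]_(i | P i) f i = f i.
Proof.
move=> Pi0; apply: (big_ind (fun y => exists2 i, P i & y = f i)).
- by exists i0.
- move=> _ _ [i Pi ->] [j Pj ->]; rewrite minEle.
  by case: ifP; [exists i|exists j].
- by move=> i Pi; exists i.
Qed.

Section SimplicialComplexes.
Context {R : realType} {n : nat}.
Implicit Types (K : pred {set 'I_n}) (s t : {set 'I_n}).

Definition down_closed K := forall s t, s \subset t -> K t -> K s.

Lemma realization_eq K K' : K =1 K' -> realization R K = realization R K'.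
Proof.
by move=> KK'; apply/seteqP; split=> x [x0 [x1 Kx]]; split=> //; split=> //;
  rewrite ?KK' // -KK'.
Qed.

(** The retraction [r] takes the smallest coordinate over [s] away from each vertex of [s] and gives
    the total to [w]. A support containing [s] thus loses a vertex of [s] and may gain [w]; the
    segment from a point to its image stays in [K] because [w] can be added to the support. *)
Lemma collapse_star K (w : 'I_n) s : down_closed K ->
  s != finset.set0 -> w \notin s ->
  (forall t, K t -> s \subset t -> K (w |: t)%SET) ->
  homotopy_equivalent R (realization R K)
    (realization R [pred t | K t && ~~ (s \subset t)]).
Proof.
move=> Kdown /finset.set0Pn[i0 i0s] ws Kw.
(* The default [x ord0 i0] does not change the minimum, as [i0] is in [s]. *)
pose m (x : 'rV[R]_n) : R := \big[Num.min/x ord0 i0]_(i in s) x ord0 i.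
pose r (x : 'rV[R]_n) : 'rV[R]_n :=
  \row_j (x ord0 j - (j \in s)%:R * m x + ((j == w)%:R * #|s|%:R) * m x).
have cm : continuous m.
  by apply: continuous_bigop => [||i];
    [exact: min_continuous|exact: coord_continuous..].
have cmZ (c : R) : continuous (fun x => c * m x).
  by move=> x; exact: (continuousM (@cst_continuous _ _ c x) (cm x)).
have cr : continuous r.
  apply: continuous_row => j; under eq_fun do rewrite mxE.
  move=> x; exact: (continuousD (continuousB (@coord_continuous _ _ _ _ _ _)
    (cmZ _ x)) (cmZ _ x)).
have m_le x i : i \in s -> m x <= x ord0 i by move=> si; exact: bigmin_le_cond.
have m_att x : exists2 i, i \in s & m x = x ord0 i by exact: bigmin_attained.
have m_ge0 (x : 'rV[R]_n) : (forall i, 0 <= x ord0 i) -> 0 <= m x.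
  by move=> x0; have [i _ ->] := m_att x; exact: x0.
have r_ge0 (x : 'rV[R]_n) : (forall i, 0 <= x ord0 i) -> forall j, 0 <= r x ord0 j.
  move=> x0 j; rewrite mxE addr_ge0 ?mulr_ge0 ?m_ge0//.
  case: (boolP (j \in s)) => js; rewrite ?mul1r ?mul0r ?subr0// subr_ge0.
  exact: m_le.
have r_sum (x : 'rV[R]_n) : \sum_i x ord0 i = 1 -> \sum_i r x ord0 i = 1.
  move=> x1; under eq_bigr do rewrite mxE.
  rewrite big_split sumrB/= x1 -!mulr_suml -natr_sum.
  have -> : (\sum_(i < n) (i \in s) = #|s|)%N.
    by rewrite -sum1_card [RHS]big_mkcond; apply: eq_bigr => i _; case: ifP.
  rewrite -natr_sum.
  have -> : (\sum_(i < n) (i == w) = 1)%N.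
    by rewrite (bigD1 w)//= eqxx big1 // => i /negbTE ->.
  by rewrite mul1r subrK.
have r_id x : m x = 0 -> r x = x.
  by move=> mx; apply/rowP => j; rewrite mxE mx !mulr0 subr0 addr0.
have m0 (x : 'rV[R]_n) : (forall i, 0 <= x ord0 i) ->
    ~~ (s \subset [set i | x ord0 i != 0]%SET) -> m x = 0.
  move=> x0 /subsetPn[i si]; rewrite inE negbK => /eqP xi.
  by apply/eqP; rewrite eq_le m_ge0// -xi m_le.
have Kr x (t : R) : 0 <= t <= 1 -> realization R K x ->
    realization R K ((1 - t) *: r x + t *: x).
  move=> /andP[t0 t1] [x0 [x1 Kx]].
  have [sx|/(m0 _ x0)/r_id ->] := boolP (s \subset [set i | x ord0 i != 0]%SET);
    last by rewrite -scalerDl subrK scale1r; split.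
  split; last split.
  - move=> i; rewrite mxE; apply: addr_ge0; rewrite mxE mulr_ge0 ?subr_ge0//.
    exact: r_ge0.
  - under eq_bigr do rewrite mxE [X in X + _]mxE [X in _ + X]mxE.
    by rewrite big_split/= -!big_distrr/= r_sum// x1 !mulr1 subrK.
  - apply: Kdown (Kw _ Kx sx); apply/fintype.subsetP => i; rewrite !inE.
    apply: contraR; rewrite negb_or negbK => /andP[iw /eqP xi].
    rewrite !mxE xi (negbTE iw) !mul0r mulr0 !addr0 sub0r.
    case: (boolP (i \in s)) => si; last by rewrite mul0r oppr0 mulr0.
    by move: (fintype.subsetP sx i si); rewrite inE xi eqxx.
apply: (@homotopy_equivalent_retract _ _ _ _ r).
- by move=> x [x0 [x1 /andP[Kx _]]]; split.
- exact: continuous_subspaceT.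
- move=> _ [x Ax <-]; have := Kr x 0; rewrite lexx ler01 subr0 scale1r scale0r addr0.
  move=> /(_ isT Ax)[r0 [r1 Krx]]; split=> //; split=> //=; rewrite Krx /=.
  have [i si mi] := m_att x; apply/subsetPn; exists i => //.
  rewrite inE negbK mxE si mul1r mi subrr add0r.
  by have -> : (i == w) = false; [apply: contraNF ws => /eqP <-|rewrite !mul0r].
- move=> x; rewrite inE => -[x0 [_ /andP[_ sx]]].
  by rewrite r_id// m0.
- by move=> t x; exact: Kr.
Qed.

(* Remove one minimal face of the difference at a time: it avoids [w], so its
   star is a cone with apex [w]. *)
Lemma collapse_cone K K' (w : 'I_n) : down_closed K -> down_closed K' ->
  K' finset.set0 -> (forall t, K' t -> K t) ->
  (forall t, K t -> ~~ K' t -> K (w |: t)%SET /\ ~~ K' (t :\ w)%SET) ->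
  homotopy_equivalent R (realization R K) (realization R K').
Proof.
have [N] := ubnP #|[set t | K t && ~~ K' t]%SET|.
elim: N K => // N IHN K; rewrite ltnS => leN Kdown K'down K'0 K'K Kw.
have [D0|[t0]] := finset.set_0Vmem [set t | K t && ~~ K' t]%SET.
  rewrite (@realization_eq K K'); first exact: homotopy_equivalent_refl.
  move=> t; apply/idP/idP => [Kt|/K'K //]; apply: contraT => K't.
  by have := finset.in_set0 t; rewrite -D0 inE Kt K't.
rewrite inE => t0D.
case: (@arg_minnP _ t0 [pred t | K t && ~~ K' t] (fun t => #|t|) t0D) => s.
move=> /andP[Ks K's] smin.
have ws : w \notin s.
  apply/negP => ws; have [_ K'sw] := Kw s Ks K's.
  have := smin (s :\ w)%SET; rewrite /= K'sw (Kdown _ s) ?subD1set// => /(_ isT).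
  by rewrite [X in (X <= _)%N](cardsD1 w) ws ltnn.
have K'star t : K' t -> ~~ (s \subset t).
  by move=> K't; apply: contra K's => /K'down; apply.
apply: homotopy_equivalent_trans (_ : homotopy_equivalent R _
    (realization R [pred t | K t && ~~ (s \subset t)])) _.
  apply: (@collapse_star _ w) => //.
    by apply: contraNneq K's => ->.
  move=> t Kt st; have K't : ~~ K' t by apply: contraL st => /K'star.
  by have [] := Kw t Kt K't.
apply: IHN => //=.
- apply: leq_trans leN; apply: proper_card; apply/fintype.properP; split.
    by apply/fintype.subsetP => t; rewrite !inE /= -andbA => /and3P[-> _ ->].
  by exists s; rewrite !inE /= ?Ks ?K's// fintype.subxx andbF.
- move=> t u tu /= /andP[Ku su]; rewrite (Kdown _ _ tu Ku).
  by apply: contra su => /fintype.subset_trans; apply.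
- by move=> t K't; rewrite K'K//= K'star.
- move=> t /andP[Kt st] K't; have [Kwt K'tw] := Kw t Kt K't.
  split=> //; rewrite Kwt; apply: contra st => /fintype.subsetP st.
  apply/fintype.subsetP => i si; have := st i si; rewrite !inE => /orP[/eqP iw|//].
  by rewrite -iw si in ws.
Qed.

End SimplicialComplexes.

(** * Change of vertex set, and the sphere as the boundary of a simplex *)

(** With [g] injective rather than bijective, deleted vertices can also be dropped from the ambient
    space. *)
Lemma realization_relabel (R : realType) (m n : nat) (g : 'I_m -> 'I_n)
    (K : pred {set 'I_m}) (L : pred {set 'I_n}) : injective g ->
  (forall s, L s -> s \subset codom g) ->
  (forall s : {set 'I_m}, L (g @: s)%SET = K s) ->
  homotopy_equivalent R (realization R K) (realization R L).
Proof.
move=> ginj Lg LK.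
pose f (x : 'rV[R]_m) : 'rV[R]_n :=
  \row_j (if [pick i | g i == j] is Some i then x ord0 i else 0).
pose h (y : 'rV[R]_n) : 'rV[R]_m := \row_i y ord0 (g i).
have fE x i : f x ord0 (g i) = x ord0 i.
  rewrite mxE; case: pickP => [i' /eqP/ginj -> //|/(_ i)].
  by rewrite eqxx.
have f0 x j : j \notin codom g -> f x ord0 j = 0.
  rewrite mxE; case: pickP => // i /eqP <-.
  by rewrite codom_f.
have sumg (y : 'rV[R]_n) : (forall j, j \notin codom g -> y ord0 j = 0) ->
    \sum_i h y ord0 i = \sum_j y ord0 j.
  move=> y0; rewrite [RHS](bigID (mem (g @: 'I_m)%SET))/= [X in _ + X]big1.
    rewrite addr0 big_imset/=; last by move=> i j _ _; exact: ginj.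
    by apply: eq_big => // i _; rewrite mxE.
  by move=> j jg; apply: y0; apply: contra jg => /codomP[i ->]; exact: imset_f.
have hK (y : 'rV[R]_n) : (forall j, j \notin codom g -> y ord0 j = 0) -> f (h y) = y.
  move=> y0; apply/rowP => j.
  have [/codomP[i ->]|jg] := boolP (j \in codom g); first by rewrite fE mxE.
  by rewrite f0// y0.
have fK x : h (f x) = x by apply/rowP => i; rewrite mxE fE.
have L0 y : realization R L y -> forall j, j \notin codom g -> y ord0 j = 0.
  move=> [_ [_ Ly]] j jg; apply/eqP; apply: contraNT jg => yj.
  by have /fintype.subsetP/(_ j) := Lg _ Ly; rewrite inE; apply.
have suppE x : [set j | f x ord0 j != 0]%SET = (g @: [set i | x ord0 i != 0])%SET.
  apply/setP => j; rewrite inE; apply/idP/finset.imsetP.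
    have [/codomP[i ->]|jg] := boolP (j \in codom g); last by rewrite f0 ?eqxx.
    by rewrite fE => xi; exists i; rewrite ?inE.
  by move=> [i]; rewrite inE => xi ->; rewrite fE.
apply: (@homotopy_equivalent_of_inverse _ _ _ _ _ f h).
- apply: continuous_subspaceT; apply: continuous_row => j.
  under eq_fun do rewrite mxE.
  by case: pickP => [i _|_]; [exact: coord_continuous|exact: cst_continuous].
- move=> _ [x [x0 [x1 Kx]] <-]; split; last split.
  + by move=> j; rewrite mxE; case: pickP.
  + by rewrite -sumg ?fK//; exact: f0.
  + by rewrite suppE LK.
- apply: continuous_subspaceT; apply: continuous_row => j.
  by under eq_fun do rewrite mxE; exact: coord_continuous.
- move=> _ [y Ay <-]; have y0 := L0 y Ay; have [yge [y1 Ly]] := Ay.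
  split; last split.
  + by move=> i; rewrite mxE.
  + by rewrite sumg.
  + by rewrite -LK -suppE hK.
- by move=> x _; exact: fK.
- by move=> y; rewrite inE => /L0; exact: hK.
Qed.

(* Centrally project the boundary of the simplex from its barycenter: read in
   the coordinates [x_i - x_0], the inverse adds to [y] the least multiple of
   [(1, ..., 1)] that makes it nonnegative. *)
Lemma boundary_simplex_sphere (R : realType) (d : nat) :
  homotopy_equivalent R
    (realization R [pred s : {set 'I_d.+2} | [exists i, i \notin s]])
    (sphere R d).
Proof.
pose u (x : 'rV[R]_d.+2) (i : 'I_d.+1) : R := x ord0 (lift ord0 i) - x ord0 ord0.
pose N (x : 'rV[R]_d.+2) : R := Num.sqrt (\sum_i u x i ^+ 2).
pose f (x : 'rV[R]_d.+2) : 'rV[R]_d.+1 := \row_i ((N x)^-1 * u x i).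
pose e (y : 'rV[R]_d.+1) (j : 'I_d.+2) : R :=
  if unlift ord0 j is Some i then y ord0 i else 0.
(* The default 0 is the value of [e y] at [ord0], so this is the minimum of all of [e y]. *)
pose m (y : 'rV[R]_d.+1) : R := \big[Num.min/0]_i y ord0 i.
pose S (y : 'rV[R]_d.+1) : R := \sum_j (e y j - m y).
pose g (y : 'rV[R]_d.+1) : 'rV[R]_d.+2 := \row_j ((S y)^-1 * (e y j - m y)).
have e0 y : e y ord0 = 0 by rewrite /e unlift_none.
have eS y i : e y (lift ord0 i) = y ord0 i by rewrite /e liftK.
have m_le y j : m y <= e y j.
  by case: (unliftP ord0 j) => [i|] ->; rewrite ?e0 ?eS;
    [exact: bigmin_le|exact: bigmin_le_id].
have m_att y : exists j, m y = e y j.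
  apply: (big_ind (fun z => exists j, z = e y j)).
  - by exists ord0; rewrite e0.
  - by move=> _ _ [j ->] [k ->]; rewrite minEle; case: ifP; [exists j|exists k].
  - by move=> i _; exists (lift ord0 i); rewrite eS.
have sq_ge0 x : 0 <= \sum_i u x i ^+ 2 by apply: sumr_ge0 => i _; exact: sqr_ge0.
have NN x : N x ^+ 2 = \sum_i u x i ^+ 2 by rewrite sqr_sqrtr.
have A0 (x : 'rV[R]_d.+2) :
    realization R [pred s : {set 'I_d.+2} | [exists i, i \notin s]] x ->
    exists2 j, x ord0 j = 0 & forall i, 0 <= x ord0 i.
  move=> [x0 [_ /existsP[j]]]; rewrite inE negbK => /eqP xj.
  by exists j.
have N_gt0 x : realization R [pred s : {set 'I_d.+2} | [exists i, i \notin s]] x ->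
    0 < N x.
  move=> Ax; have [j xj _] := A0 x Ax; have [_ [x1 _]] := Ax.
  rewrite lt_neqAle sqrtr_ge0 andbT eq_sym sqrtr_eq0 -ltNge lt_neqAle sq_ge0 andbT.
  apply: contra_eq_neq x1 => /esym/eqP; rewrite psumr_eq0; last first.
    by move=> i _; exact: sqr_ge0.
  move=> /allP xx.
  have xc k : x ord0 k = x ord0 ord0.
    case: (unliftP ord0 k) => [i|] -> //; apply/eqP; rewrite -subr_eq0.
    by have := xx i (mem_index_enum i); rewrite /= sqrf_eq0.
  rewrite big1 ?[0 == 1]eq_sym ?oner_eq0// => k _.
  by rewrite xc -(xc j).
have S_gt0 y : sphere R d y -> 0 < S y.
  move=> y1; rewrite lt_neqAle sumr_ge0 ?andbT; last by move=> i _; rewrite subr_ge0.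
  apply/negP; rewrite eq_sym psumr_eq0; last by move=> i _; rewrite subr_ge0.
  move=> /allP ey; have ec j : e y j = m y.
    by apply/eqP; rewrite -subr_eq0; exact: ey (mem_index_enum j).
  have : \sum_i (y ord0 i) ^+ 2 = 0.
    by apply: big1 => i _; rewrite -eS ec -(ec ord0) e0 expr0n.
  by rewrite y1 => /eqP; rewrite oner_eq0.
have cu i : continuous (u ^~ i).
  move=> x; exact: (continuousB (@coord_continuous _ _ _ _ _ _)
    (@coord_continuous _ _ _ _ _ _)).
have cN : continuous N.
  move=> x; apply: (@continuous_comp _ _ _ (fun x => \sum_i u x i ^+ 2)); last first.
    exact: sqrt_continuous.
  apply: continuous_bigop; [exact: add_continuous|exact: cst_continuous|].
  by move=> i z; exact: (continuousM (cu i z) (cu i z)).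
have cm : continuous m.
  apply: continuous_bigop; [exact: min_continuous|exact: cst_continuous|].
  by move=> i; exact: coord_continuous.
have ce j : continuous (e ^~ j).
  by rewrite /e; case: unlift => [i|]; [exact: coord_continuous|exact: cst_continuous].
have cem j : continuous (fun y => e y j - m y).
  by move=> y; exact: (continuousB (ce j y) (cm y)).
have cS : continuous S.
  by apply: continuous_bigop; [exact: add_continuous|exact: cst_continuous|exact: cem].
have fu x i : f x ord0 i = (N x)^-1 * u x i by rewrite mxE.
have gE y j : g y ord0 j = (S y)^-1 * (e y j - m y) by rewrite mxE.
apply: (@homotopy_equivalent_of_inverse _ _ _ _ _ f g).
- apply/subspace_continuousP => x Ax; apply: cvg_within_filter.
  apply: (@cvg_rowP _ _ _ (nbhs x)) => i; under eq_fun do rewrite fu; rewrite fu.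
  by apply: continuousM (cu i x); apply: continuousV (cN x); rewrite gt_eqF ?N_gt0.
- move=> _ [x Ax <-]; rewrite /sphere /=; under eq_bigr do rewrite fu exprMn.
  by rewrite -big_distrr/= -NN -exprMn mulVf ?expr1n// gt_eqF ?N_gt0.
- apply/subspace_continuousP => y By; apply: cvg_within_filter.
  apply: (@cvg_rowP _ _ _ (nbhs y)) => j; under eq_fun do rewrite gE; rewrite gE.
  by apply: continuousM (cem j y); apply: continuousV (cS y); rewrite gt_eqF ?S_gt0.
- move=> _ [y By <-]; have Sy := S_gt0 y By; split; last split.
  + by move=> j; rewrite gE mulr_ge0 ?invr_ge0 ?(ltW Sy)// subr_ge0.
  + by under eq_bigr do rewrite gE; rewrite -big_distrr/= mulVf// gt_eqF.
  + have [j mj] := m_att y; apply/existsP; exists j.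
    by rewrite inE negbK gE mj subrr mulr0.
- move=> x; rewrite inE => Ax; have Nx := N_gt0 x Ax; have [j xj x0] := A0 x Ax.
  have ef k : e (f x) k = (N x)^-1 * (x ord0 k - x ord0 ord0).
    case: (unliftP ord0 k) => [i|] ->; first by rewrite eS fu.
    by rewrite e0 subrr mulr0.
  have mf : m (f x) = - ((N x)^-1 * x ord0 ord0).
    apply/eqP; rewrite eq_le; apply/andP; split.
      by apply: le_trans (m_le _ j) _; rewrite ef xj sub0r mulrN.
    have [k ->] := m_att (f x).
    by rewrite ef mulrBr lerDr mulr_ge0// invr_ge0 ltW.
  have ex k : e (f x) k - m (f x) = (N x)^-1 * x ord0 k.
    by rewrite ef mf opprK mulrBr subrK.
  have Sx : S (f x) = (N x)^-1.
    rewrite /S; under eq_bigr do rewrite ex.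
    by rewrite -big_distrr/=; have [_ [-> _]] := Ax; rewrite mulr1.
  by apply/rowP => k; rewrite gE ex Sx invrK mulrA mulfV ?mul1r// gt_eqF.
- move=> y; rewrite inE => By; have Sy := S_gt0 y By.
  have ug i : u (g y) i = (S y)^-1 * y ord0 i.
    by rewrite /u !gE eS e0 -mulrBr opprB addrA subrK subr0.
  have Ng : N (g y) = (S y)^-1.
    rewrite /N; under eq_bigr do rewrite ug exprMn.
    rewrite -big_distrr/=; move: By; rewrite /sphere /= => ->.
    by rewrite mulr1 sqrtr_sqr ger0_norm// invr_ge0 ltW.
  by apply/rowP => i; rewrite fu ug Ng invrK mulrA mulfV ?mul1r// gt_eqF.
Qed.

(** * Sets covered by two arcs of a cycle *)

Section TwoArcs.
Local Open Scope nat_scope.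

(* [x] lies on the arc of the cycle Z/n that starts at [a] and has [l] steps,
   where [a, x < n]. *)
Definition arc (n l a x : nat) : bool := (a <= x <= a + l) || (x + n <= a + l).

(** The only long arcs that the descent meets start at 0 and at 1; one flag stands for each. *)
Definition arc_len (k : nat) (s t : bool) (a : nat) : nat :=
  k + (s && (a == 0)) + (t && (a == 1)).

Definition arc_cover (n k : nat) (s t : bool) (p : nat -> bool) : Prop :=
  exists a b, [/\ a < n, b < n & forall x, p x ->
    arc n (arc_len k s t a) a x || arc n (arc_len k s t b) b x].

(** Faces become predicates on natural numbers, so that covering by arcs is a matter of linear
    arithmetic. *)
Definition mem_val (n : nat) (s : {set 'I_n}) (x : nat) : bool :=
  [exists i in s, val i == x].

Definition two_arcs (n k : nat) (s t : bool) (u : {set 'I_n}) : bool :=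
  `[< arc_cover n k s t (mem_val u) >].

Lemma mem_valE (n : nat) (s : {set 'I_n}) (i : 'I_n) : mem_val s i = (i \in s).
Proof.
apply/existsP/idP => [[j /andP[js /eqP/val_inj <-]] //|si].
by exists i; rewrite si eqxx.
Qed.

Lemma mem_val_lt (n : nat) (s : {set 'I_n}) (x : nat) : mem_val s x -> x < n.
Proof. by case/existsP => j /andP[_ /eqP <-]; exact: ltn_ord. Qed.

Lemma mem_valU1 (n : nat) (s : {set 'I_n}) (w : 'I_n) (x : nat) :
  mem_val (w |: s)%SET x = (x == w) || mem_val s x.
Proof.
have [xn|nx] := ltnP x n; first by rewrite (mem_valE _ (Ordinal xn)) !inE -mem_valE.
have out (u : {set 'I_n}) : mem_val u x = false.
  by apply: contraTF nx => /mem_val_lt; rewrite -ltnNge.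
rewrite !out orbF; apply/esym/negbTE; apply: contraTneq nx => ->.
by rewrite -ltnNge.
Qed.

Lemma mem_valD1 (n : nat) (s : {set 'I_n}) (w : 'I_n) (x : nat) :
  mem_val (s :\ w)%SET x = (x != w) && mem_val s x.
Proof.
have [xn|nx] := ltnP x n; first by rewrite (mem_valE _ (Ordinal xn)) !inE -mem_valE.
have out (u : {set 'I_n}) : mem_val u x = false.
  by apply: contraTF nx => /mem_val_lt; rewrite -ltnNge.
by rewrite !out andbF.
Qed.

Lemma mem_val_sub (n : nat) (s u : {set 'I_n}) (x : nat) :
  s \subset u -> mem_val s x -> mem_val u x.
Proof.
move=> /fintype.subsetP su /existsP[i /andP[si ix]].
by apply/existsP; exists i; rewrite su.
Qed.

Lemma arc_cover_sub (n k : nat) (s t : bool) (p q : nat -> bool) :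
  (forall x, p x -> q x) -> arc_cover n k s t q -> arc_cover n k s t p.
Proof. by move=> pq [a [b [an bn ab]]]; exists a, b; split=> // x /pq/ab. Qed.

Lemma two_arcs_down (n k : nat) (s t : bool) : down_closed (@two_arcs n k s t).
Proof.
by move=> u v uv /asboolP c; apply/asboolP/(arc_cover_sub _ c) => x; exact: mem_val_sub.
Qed.

Lemma two_arcs0 (n k : nat) (s t : bool) :
  0 < n -> two_arcs k s t (finset.set0 : {set 'I_n}).
Proof.
move=> n0; apply/asboolP; exists 0, 0; split=> // x /existsP[i].
by rewrite finset.in_set0.
Qed.

(** * Sets that need the long arc *)

Section LongArc.
Context (k : nat) (t : bool) (k3 : 3 <= k).
Let n := 3 * k + 2.
Implicit Types p : nat -> bool.

Definition far_arc p := exists b, b < n /\ forall x, p x -> k + 1 < x -> arc n k b x.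

(* The set [p] needs the long arc from 0 to [k + 1]: the arc ending at [b1] and
   the one starting at [b2] both miss [e]. *)
Definition witness p (e b1 b2 : nat) : bool :=
  [&& p e, p b1, p b2, 0 < e <= k, e + k + (t && (e == 1)) < b1 <= 2 * k + 1
    & 2 * k + 1 < b2 < e + 2 * k + 2].

(** Without 0 the arc at 1 could replace the long arc, and without k + 1 the short arc at 0 would
    do. The other arc may be given k steps even when it starts at 1, since that arc reaches at most
    k + 2 beyond k + 1. *)
Lemma raise_far p : arc_cover n k true t p -> ~ arc_cover n k false t p ->
  [/\ p 0, p (k + 1) & far_arc p].
Proof.
move=> [a [b [an bn pab]]] nO.
have [ab|ab] := boolP ((a != 0) && (b != 0)).
  exfalso; apply: nO; exists a, b; split=> // x /pab; rewrite /arc_len/=.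
  by move: ab => /andP[/negbTE -> /negbTE ->].
wlog a0 : a b an bn pab ab / a = 0.
  move=> wl; have [/eqP a0|an0] := boolP (a == 0); first exact: (wl a b).
  apply: (wl b a) => //; last lia.
    by move=> x /pab; rewrite orbC.
  by rewrite andbC.
rewrite {a an ab}a0 in pab; split.
- apply: contrapT => p0; apply: nO.
  exists 1, (if b == 0 then 1 else b); split; rewrite /n; [lia|by case: ifP; lia|].
  move=> x px; have x0 : x <> 0 by move=> x0; apply: p0; rewrite -x0.
  move: (pab x px); rewrite /arc /arc_len; case: ifP => /eqP b0; lia.
- apply: contrapT => p0; apply: nO.
  exists 0, b; split; rewrite /n; [lia|by []|].
  move=> x px; have x0 : x <> k + 1 by move=> x0; apply: p0; rewrite -x0.
  move: (pab x px); rewrite /arc /arc_len; lia.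
- exists (if b == 1 then k + 2 else b); split; first by rewrite /n; case: ifP; lia.
  move=> x px kx; move: (pab x px); rewrite /arc /arc_len /n.
  case: ifP => /eqP b0; lia.
Qed.

(** If the range of b1 is empty, the arcs at 1 and 2k + 2 cover; if that of b2 is empty, those at 0
    and k + 1 do. Otherwise take b1 largest and b2 smallest: any vertex missed by the arc ending at
    b1 and the arc starting at b2 is the e of a witness. *)
Lemma raise_witness p : arc_cover n k true t p -> ~ arc_cover n k false t p ->
  (forall x, p x -> x < n) -> exists e b1 b2, witness p e b1 b2.
Proof.
move=> pN pO pn; have [p0 pk [b [bn pb]]] := raise_far pN pO.
apply: contrapT => nw; apply: pO.
have [[y y1]|n1] := pselect (exists y, p y && (k + 1 < y <= 2 * k + 1)); last first.
  exists 1, (2 * k + 2); split; rewrite /n; [lia..|] => x px.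
  have := pn x px; have : ~~ (k + 1 < x <= 2 * k + 1).
    by apply/negP => x1; apply: n1; exists x; rewrite px.
  rewrite /arc /arc_len /n; lia.
have [[z z2]|n2] := pselect (exists z, p z && (2 * k + 1 < z)); last first.
  exists 0, (k + 1); split; rewrite /n; [lia..|] => x px.
  have := pn x px; have : ~~ (2 * k + 1 < x).
    by apply/negP => x1; apply: n2; exists x; rewrite px.
  rewrite /arc /arc_len /n; lia.
have [b1 /andP[pb1 b1k] b1max] := ex_maxnP (ex_intro _ y y1)
  (fun i (h : p i && (k + 1 < i <= 2 * k + 1)) => proj2 (andP (proj2 (andP h)))).
have [b2 /andP[pb2 b2k] b2min] := ex_minnP
  (ex_intro (fun z => is_true (p z && (2 * k + 1 < z))) z z2).
(* For b1 = k + 2 the long arc at 1 also ends at b1 and covers 1 besides; this is the exception for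
   e = 1 in [witness]. *)
exists (if t && (b1 - k == 2) then 1 else b1 - k), b2; split.
- by rewrite /n; case: ifP; lia.
- exact: pn.
move=> x px; have xn := pn x px; have b2n := pn _ pb2.
have h1 : k + 1 < x <= 2 * k + 1 -> x <= b1 by move=> h; apply: b1max; rewrite px.
have h2 : 2 * k + 1 < x -> b2 <= x by move=> h; apply: b2min; rewrite px.
have h3 : ~~ [&& 0 < x <= k, x + k + (t && (x == 1)) < b1 <= 2 * k + 1
    & 2 * k + 1 < b2 < x + 2 * k + 2].
  by apply/negP => h; apply: nw; exists x, b1, b2; rewrite /witness px pb1 pb2.
move: h1 h2 h3 xn b2n; rewrite /arc /arc_len /n; case: ifP; lia.
Qed.

(** No arc contains both 0 and k + 1, so each arc takes one of them. An arc through e and k + 1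
    stops before b1, which is too far from 0 for the other arc; an arc through 0 and e misses b2,
    which is too far from k + 1. *)
Lemma witness_not_cover p e b1 b2 : p 0 -> p (k + 1) -> witness p e b1 b2 ->
  ~ arc_cover n k false t p.
Proof.
move=> p0 pk /and5P[pe pb1 pb2 ek /andP[b1k b2k]] [a [b [an bn pab]]].
move: (pab _ p0) (pab _ pk) (pab _ pe) (pab _ pb1) (pab _ pb2) ek b1k b2k an bn.
rewrite /arc /arc_len /n; clear -k3; lia.
Qed.

End LongArc.
End TwoArcs.

(** * Lengthening one arc by four collapses *)

Section Raise.
Local Open Scope nat_scope.
Context {R : realType}.

(** An upward closed [Q] cuts out a complex between [O] and [N], equal to [N] for the empty [Q] and
    to [O] for the full one. Enlarging [Q] in stages lets each stage have its own apex. *)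
Lemma collapse_cone_layer (n : nat) (N O Q Q' : pred {set 'I_n}) (w : 'I_n) :
  down_closed N -> down_closed O -> O finset.set0 ->
  (forall u, O u -> N u) -> (forall u, Q u -> Q' u) ->
  (forall u v : {set 'I_n}, u \subset v -> Q u -> Q v) ->
  (forall u v : {set 'I_n}, u \subset v -> Q' u -> Q' v) ->
  (forall u, N u -> ~~ O u -> ~~ Q u -> Q' u ->
    [/\ N (w |: u)%SET, ~~ Q (w |: u)%SET, ~~ O (u :\ w)%SET & Q' (u :\ w)%SET]) ->
  homotopy_equivalent R
    (realization R [pred u | N u && (O u || ~~ Q u)])
    (realization R [pred u | N u && (O u || ~~ Q' u)]).
Proof.
move=> Nd Od O0 ON QQ' Qup Q'up Hw.
have down (P : pred {set 'I_n}) :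
    (forall u v : {set 'I_n}, u \subset v -> P u -> P v) ->
    down_closed [pred u | N u && (O u || ~~ P u)].
  move=> Pup u v uv /= /andP[Nv OPv]; rewrite (Nd _ _ uv Nv)/=.
  by case/orP: OPv => [/(Od _ _ uv) ->//|Pv]; rewrite (contra (Pup u v uv) Pv) orbT.
apply: (@collapse_cone _ _ _ _ w); [exact: down|exact: down| | |].
- by rewrite /= O0 ON.
- by move=> u /= /andP[-> /orP[->//|/(contra (QQ' u)) ->]]; rewrite orbT.
move=> u /= /andP[Nu OQu]; rewrite Nu negb_or negbK => /andP[Ou Q'u].
rewrite (negbTE Ou)/= in OQu; have [-> -> /negbTE -> ->] := Hw u Nu Ou OQu Q'u.
by rewrite orbT andbF.
Qed.

Section Steps.
Context (k : nat) (t : bool) (k3 : 3 <= k).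
Notation n := (3 * k + 2).
Implicit Types u v : {set 'I_n}.

Definition inner_witness u : bool :=
  `[< exists e b1 b2, 1 < e /\ witness k t (mem_val u) e b1 b2 >].

Lemma inner_witness_up u v : u \subset v -> inner_witness u -> inner_witness v.
Proof.
move=> uv /asboolP[e [b1 [b2 [e1 /and5P[pe p1 p2 ek bb]]]]].
apply/asboolP; exists e, b1, b2; split=> //.
by rewrite /witness (mem_val_sub uv pe) (mem_val_sub uv p1) (mem_val_sub uv p2) ek.
Qed.

Lemma raise_facts u : two_arcs k true t u -> ~~ two_arcs k false t u ->
  [/\ mem_val u 0, mem_val u (k + 1), far_arc k (mem_val u) &
    exists e b1 b2, witness k t (mem_val u) e b1 b2].
Proof.
move=> /asboolP uN /asboolP uO; have [u0 uk uf] := raise_far k3 uN uO.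
by split=> //; apply: raise_witness => // x; exact: mem_val_lt.
Qed.

Lemma raise_not_cover u e b1 b2 : mem_val u 0 -> mem_val u (k + 1) ->
  witness k t (mem_val u) e b1 b2 -> ~~ two_arcs k false t u.
Proof. by move=> u0 uk uw; apply/asboolP; exact: witness_not_cover uw. Qed.

Lemma raise_cover u b : b < n ->
  (forall x, mem_val u x -> k + 1 < x -> arc n k b x) -> two_arcs k true t u.
Proof.
move=> bn ub; apply/asboolP; exists 0, b; split=> // [|x ux]; first by lia.
have := ub x ux; rewrite /arc /arc_len; lia.
Qed.

(* A witness that is not inner has [e = 1], hence [b2 = 2k + 2]. *)
Lemma outer_witness u :
  (exists e b1 b2, witness k t (mem_val u) e b1 b2) -> ~~ inner_witness u ->
  exists b1, [/\ mem_val u 1, mem_val u (2 * k + 2), mem_val u b1 &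
    k + 1 + t < b1 <= 2 * k + 1].
Proof.
move=> [e [b1 [b2 uw]]] /asboolP ni.
have e1 : e = 1.
  apply: contrapT => ne1; apply: ni; exists e, b1, b2; split=> //.
  by move: uw => /and5P[_ _ _ + _]; clear -ne1; lia.
move: uw => /and5P[ue u1 u2 _ /andP[b1k b2k]]; exists b1.
rewrite e1 in ue b1k b2k; split=> //.
  by have <- : b2 = 2 * k + 2 by clear -b2k; lia.
by clear -b1k; lia.
Qed.

Lemma no_inner_witness u x : ~~ inner_witness u -> mem_val u (2 * k + 1) ->
  mem_val u (2 * k + 2) -> 1 < x <= k -> ~~ mem_val u x.
Proof.
move=> /asboolP ni u1 u2 xk; apply/negP => ux; apply: ni.
exists x, (2 * k + 1), (2 * k + 2); split; first by case/andP: xk.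
rewrite /witness ux u1 u2; clear -xk; lia.
Qed.

(** A witness with e > 1 does not use the vertex 1, which lies on the long arc; so 1 serves as
    apex. *)
Lemma layer_inner u (w : 'I_n) : w = 1 :> nat ->
  two_arcs k true t u -> ~~ two_arcs k false t u -> inner_witness u ->
  [/\ two_arcs k true t (w |: u)%SET, ~~ two_arcs k false t (u :\ w)%SET &
    inner_witness (u :\ w)%SET].
Proof.
move=> w1 Nu Ou /asboolP[e [b1 [b2 [e1 /and5P[ue u1 u2 ek bb]]]]].
have [u0 uk [b [bn ub]] _] := raise_facts Nu Ou.
have uw : witness k t (mem_val (u :\ w)%SET) e b1 b2.
  rewrite /witness !mem_valD1 ue u1 u2 ek w1; move: e1 bb; clear; lia.
split.
- apply: (raise_cover bn) => x; rewrite mem_valU1 w1 => /orP[/eqP ->|/ub//].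
  by clear -k3; lia.
- apply: raise_not_cover uw; rewrite mem_valD1 ?u0 ?uk w1; clear -k3; lia.
- by apply/asboolP; exists e, b1, b2.
Qed.

(** With 2k + 1 and 2k + 2 in [u], any e of [u] with 1 < e <= k would already give an inner witness,
    and [w] is too large to be a new e. Deleting [w] spares the witness 1, 2k + 1, 2k + 2. *)
Lemma layer_ends_facts u :
  two_arcs k true t u -> ~~ two_arcs k false t u -> ~~ inner_witness u ->
  mem_val u (2 * k + 1) -> forall w : 'I_n, 2 * k <= w -> w != 2 * k + 1 :> nat ->
  w != 2 * k + 2 :> nat ->
  ~~ inner_witness (w |: u)%SET /\ ~~ two_arcs k false t (u :\ w)%SET.
Proof.
move=> Nu Ou ni u1 w wk w1 w2.
have [u0 uk _ uw] := raise_facts Nu Ou.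
have [_ [up1 u2 _ _]] := outer_witness uw ni; split.
- apply: contra (ni) => /asboolP[e [c1 [c2 [e1 /and5P[+ _ _ ek _]]]]].
  rewrite mem_valU1 => /orP[|ue]; first by clear -k3 ek wk; lia.
  have := no_inner_witness (x := e) ni u1 u2; rewrite ue.
  by clear -e1 ek; lia.
- apply: (@raise_not_cover _ 1 (2 * k + 1) (2 * k + 2)).
  + by rewrite mem_valD1 u0 andbT; clear -k3 wk; lia.
  + by rewrite mem_valD1 uk andbT; clear -k3 wk; lia.
  + rewrite /witness !mem_valD1 up1 u1 u2 !andbT ![_ == w :> nat]eq_sym w1 w2.
    by clear -k3 wk; lia.
Qed.

(** The only arc of k steps through 2k + 1 and 3k + 1 joins them, and it passes through 2k + 3. *)
Lemma layer_far_cover u (w : 'I_n) : w = 2 * k + 3 :> nat ->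
  two_arcs k true t u -> ~~ two_arcs k false t u ->
  mem_val u (2 * k + 1) -> mem_val u (3 * k + 1) -> two_arcs k true t (w |: u)%SET.
Proof.
move=> wk Nu Ou u1 u3; have [u0 uk [b [bn ub]] _] := raise_facts Nu Ou.
have b1 : arc n k b (2 * k + 1) by apply: ub => //; clear -k3; lia.
have b3 : arc n k b (3 * k + 1) by apply: ub => //; clear -k3; lia.
apply: (raise_cover bn) => x; rewrite mem_valU1 wk => /orP[/eqP ->|/ub//].
by move: b1 b3; rewrite /arc; clear -k3 bn; lia.
Qed.

(** If the far arc starts at 2k + 1, it can be shifted one step back: all it loses is 3k + 1. *)
Lemma layer_near_cover u (w : 'I_n) : w = 2 * k :> nat ->
  two_arcs k true t u -> ~~ two_arcs k false t u -> mem_val u (2 * k + 2) ->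
  mem_val u (2 * k + 1) -> ~~ mem_val u (3 * k + 1) ->
  two_arcs k true t (w |: u)%SET.
Proof.
move=> wk Nu Ou u2 u1 u3; have [u0 uk [b [bn ub]] _] := raise_facts Nu Ou.
have b1 : arc n k b (2 * k + 1) by apply: ub => //; clear -k3; lia.
have b2 : arc n k b (2 * k + 2) by apply: ub => //; clear -k3; lia.
apply: (@raise_cover _ (if b == 2 * k + 1 then 2 * k else b)).
  by case: ifP => // _; clear -k3; lia.
move=> x; rewrite mem_valU1 wk => /orP[/eqP ->|ux kx].
  by move: b1 b2; rewrite /arc; clear -k3 bn; case: ifP; lia.
have x3 : x <> 3 * k + 1 by move=> x3; rewrite -x3 ux in u3.
have := ub x ux kx; have := mem_val_lt ux; rewrite /arc; clear -k3 x3.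
by case: ifP; lia.
Qed.

(** Taken as e, the vertex k would need b1 = 2k + 1, which is absent; so adding k creates no inner
    witness, and the outer one does not use k. *)
Lemma layer_last u (w : 'I_n) : w = k :> nat ->
  two_arcs k true t u -> ~~ two_arcs k false t u -> ~~ inner_witness u ->
  ~~ mem_val u (2 * k + 1) ->
  [/\ two_arcs k true t (w |: u)%SET, ~~ inner_witness (w |: u)%SET &
    ~~ two_arcs k false t (u :\ w)%SET].
Proof.
move=> wk Nu Ou ni u1; have [u0 uk [b [bn ub]] uw] := raise_facts Nu Ou.
have [b1 [up1 u2 ub1 b1k]] := outer_witness uw ni; split.
- apply: (raise_cover bn) => x; rewrite mem_valU1 wk => /orP[/eqP ->|/ub//].
  by clear; lia.
- apply: contra (ni) => /asboolP[e [c1 [c2 [e1 /and5P[ue uc1 uc2 ek /andP[c1k c2k]]]]]].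
  move: ue uc1 uc2; rewrite !mem_valU1 wk => ue uc1 uc2.
  have {}uc1 : mem_val u c1.
    by case/orP: uc1 => // /eqP c1E; move: ek c1k; rewrite c1E; clear; lia.
  have {}uc2 : mem_val u c2.
    by case/orP: uc2 => // /eqP c2E; move: c2k; rewrite c2E; clear; lia.
  have c1' : c1 <> 2 * k + 1 by move=> c1'; rewrite -c1' uc1 in u1.
  have {}ue : mem_val u e.
    by case/orP: ue => // /eqP eE; move: c1k; rewrite eE; clear -c1'; lia.
  apply/asboolP; exists e, c1, c2; split=> //.
  by rewrite /witness ue uc1 uc2 ek c1k.
- have b1' : b1 <> 2 * k + 1 by move=> b1'; rewrite -b1' ub1 in u1.
  apply: (@raise_not_cover _ 1 b1 (2 * k + 2)).
  + by rewrite mem_valD1 u0 wk andbT; clear -k3; lia.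
  + by rewrite mem_valD1 uk wk andbT; clear -k3; lia.
  + rewrite /witness !mem_valD1 up1 ub1 u2 wk; clear -k3 b1' b1k; lia.
Qed.

Lemma raise_arc : homotopy_equivalent R
  (realization R (@two_arcs n k true t)) (realization R (@two_arcs n k false t)).
Proof.
pose N : pred {set 'I_n} := @two_arcs n k true t.
pose O : pred {set 'I_n} := @two_arcs n k false t.
(* Faces without inner witness are split by 2k + 1, then by 3k + 1, where an arc starting at 2k + 1
   ends. The apexes of the four layers are 1, 2k + 3, 2k and k. *)
pose Q2 u := inner_witness u || (mem_val u (2 * k + 1) && mem_val u (3 * k + 1)).
pose Q3 u := inner_witness u || mem_val u (2 * k + 1).
have w1 : 1 < n by clear; lia.
have w2 : 2 * k + 3 < n by clear -k3; lia.
have w3 : 2 * k < n by clear; lia.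
have w4 : k < n by clear; lia.
have ON u : O u -> N u.
  move=> /asboolP[a [b [an bn ab]]]; apply/asboolP; exists a, b; split=> // x /ab.
  by rewrite /arc /arc_len; clear; lia.
have Q2up u v : u \subset v -> Q2 u -> Q2 v.
  by move=> uv /orP[/(inner_witness_up uv)|/andP[/(mem_val_sub uv) + /(mem_val_sub uv)]];
    rewrite /Q2 => ->; rewrite ?orbT// => ->; rewrite orbT.
have Q3up u v : u \subset v -> Q3 u -> Q3 v.
  by move=> uv /orP[/(inner_witness_up uv)|/(mem_val_sub uv)];
    rewrite /Q3 => ->; rewrite ?orbT.
have NE : N =1 [pred u | N u && (O u || ~~ pred0 u)].
  by move=> u /=; rewrite orbT andbT.
have OE : O =1 [pred u | N u && (O u || ~~ predT u)].
  by move=> u /=; rewrite orbF; apply/idP/andP => [Ou|[]//]; split=> //; exact: ON.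
have Nd : down_closed N by exact: two_arcs_down.
have Od : down_closed O by exact: two_arcs_down.
have O0 : O finset.set0 by apply: two_arcs0; clear -w1; lia.
have layer Q Q' w := @collapse_cone_layer n N O Q Q' w Nd Od O0 ON.
rewrite -/N -/O (realization_eq NE) (realization_eq OE).
apply: homotopy_equivalent_trans
  (layer pred0 inner_witness (Ordinal w1) _ _ _ _) _ => //.
- exact: inner_witness_up.
- by move=> u Nu Ou _ iu; have [] := @layer_inner u (Ordinal w1) erefl Nu Ou iu.
apply: homotopy_equivalent_trans
  (layer inner_witness Q2 (Ordinal w2) _ _ _ _) _ => //.
- by move=> u iu; rewrite /Q2 iu.
- exact: inner_witness_up.
- move=> u Nu Ou ni; rewrite {1}/Q2 (negbTE ni)/= => /andP[u1 u3].
  have [|||-> ->] := @layer_ends_facts u Nu Ou ni u1 (Ordinal w2);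
    [by clear; rewrite /=; lia..|].
  split=> //; first exact: (@layer_far_cover u (Ordinal w2)).
  (* Here k >= 3 is what keeps the apex 2k + 3 distinct from 3k + 1. *)
  rewrite /Q2 !mem_valD1 u1 u3 /= !andbT; apply/orP; right; clear -k3; lia.
apply: homotopy_equivalent_trans (layer Q2 Q3 (Ordinal w3) _ _ _ _) _ => //.
- by move=> u /orP[iu|/andP[u1 _]]; rewrite /Q3 ?iu ?u1 ?orbT.
- move=> u Nu Ou; rewrite {1}/Q2 {1}/Q3 negb_or negb_and => /andP[ni u3].
  rewrite (negbTE ni)/= => u1; rewrite u1/= in u3.
  have [u0 uk _ uw] := raise_facts Nu Ou.
  have [_ [up1 u2 _ _]] := outer_witness uw ni.
  have [|||niw ->] := @layer_ends_facts u Nu Ou ni u1 (Ordinal w3);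
    [by clear; rewrite /=; lia..|].
  split=> //; first exact: (@layer_near_cover u (Ordinal w3)).
    rewrite /Q2 negb_or niw !mem_valU1 (negbTE u3) /=; clear -k3; lia.
  rewrite /Q3 !mem_valD1 u1 /= !andbT; apply/orP; right; clear -k3; lia.
apply: (layer Q3 predT (Ordinal w4)) => // u Nu Ou; rewrite {1}/Q3 negb_or.
move=> /andP[ni u1] _; have [Nw niw Ow] := @layer_last u (Ordinal w4) erefl Nu Ou ni u1.
split=> //; by rewrite /Q3 negb_or niw mem_valU1 (negbTE u1) orbF /=; clear -k3; lia.
Qed.

End Steps.
End Raise.

(** * Deleting dominated vertices: the descent in k and its base *)

Section Reduction.
Local Open Scope nat_scope.
Context {R : realType}.

Lemma mem_val_imset (m n : nat) (g : 'I_m -> 'I_n) (u : {set 'I_m}) (y : nat) :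
  mem_val (g @: u)%SET y <-> exists2 i, i \in u & g i = y :> nat.
Proof.
split=> [/existsP[j /andP[/finset.imsetP[i iu ->] /eqP gi]]|[i iu <-]].
  by exists i.
by rewrite mem_valE imset_f.
Qed.

(** Inclusions of arcs in both directions suffice: an arc may be sent to a larger one, and the two
    families need not be in bijection. *)
Lemma two_arcs_imset (m n k k' : nat) (s t s' t' : bool) (g : 'I_m -> 'I_n) :
  (forall a, a < n -> exists2 a', a' < m & forall i : 'I_m,
     arc n (arc_len k s t a) a (g i) -> arc m (arc_len k' s' t' a') a' i) ->
  (forall a', a' < m -> exists2 a, a < n & forall i : 'I_m,
     arc m (arc_len k' s' t' a') a' i -> arc n (arc_len k s t a) a (g i)) ->
  forall u : {set 'I_m}, two_arcs k s t (g @: u)%SET = two_arcs k' s' t' u.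
Proof.
move=> fwd bwd u; apply/asboolP/asboolP => -[a [b [an bn ab]]].
  have [a' am Ha] := fwd a an; have [b' bm Hb] := fwd b bn.
  exists a', b'; split=> // x ux; have xm := mem_val_lt ux.
  have /ab : mem_val (g @: u)%SET (g (Ordinal xm)).
    by apply/mem_val_imset; exists (Ordinal xm); rewrite // -mem_valE.
  by move=> /orP[/Ha|/Hb] ->; rewrite ?orbT.
have [a' am Ha] := bwd a an; have [b' bm Hb] := bwd b bn.
exists a', b'; split=> // x /mem_val_imset[i iu <-].
have /ab : mem_val u i by rewrite mem_valE.
by move=> /orP[/Ha|/Hb] ->; rewrite ?orbT.
Qed.

Lemma two_arcs_rotate (n k : nat) : 1 < n -> k < n ->
  homotopy_equivalent R (realization R (@two_arcs n k true false))
    (realization R (@two_arcs n k false true)).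
Proof.
case: n => // n n1 kn.
have ordSE (i : 'I_n.+1) :
    (i = n :> nat) /\ (ordS i = 0 :> nat) \/ (i < n) /\ (ordS i = i.+1 :> nat).
  rewrite /=; have [iE|ni] := eqVneq (i : nat) n; first by left; rewrite iE modnn.
  have lin : i < n by have := ltn_ord i; clear -ni; lia.
  by right; rewrite modn_small.
apply: (@realization_relabel _ _ _ (@ordS n.+1)); first exact: ordS_inj.
  move=> u _; apply/fintype.subsetP => i _.
  by rewrite -(ord_predK i) codom_f.
apply: two_arcs_imset => a an.
  exists (if a == 0 then n else a.-1); first by case: ifP; clear -an; lia.
  move=> i; rewrite /arc /arc_len; have := ordSE i; clear -an n1 kn.
  by case: ifP; lia.
exists (if a == n then 0 else a.+1); first by case: ifP; clear -an; lia.
move=> i; rewrite /arc /arc_len; have := ordSE i; clear -an n1 kn.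
by case: ifP; lia.
Qed.

(** The removed faces are those through [v], and adding or deleting [w] keeps [v]. *)
Lemma collapse_vertex (n : nat) (K : pred {set 'I_n}) (v w : 'I_n) :
  down_closed K -> K finset.set0 -> v != w ->
  (forall u, K u -> v \in u -> K (w |: u)%SET) ->
  homotopy_equivalent R (realization R K)
    (realization R [pred u | K u && (v \notin u)]).
Proof.
move=> Kd K0 vw Kw; apply: (@collapse_cone _ _ _ _ w) => //.
- move=> s u su /= /andP[Ku vu]; rewrite (Kd _ _ su Ku).
  by apply: contra vu => /(fintype.subsetP su).
- by rewrite /= K0 finset.in_set0.
- by move=> u /andP[].
- move=> u Ku; rewrite /= Ku negbK => vu; split; first exact: Kw.
  by rewrite !inE vw vu andbF.
Qed.

(** Arcs are compared on [u] only, so that the new arc may lose vertices deleted earlier. *)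
Lemma two_arcs_dominated (n k : nat) (s t : bool) (v w : 'I_n) (u : {set 'I_n}) :
  (forall a, a < n -> exists2 a', a' < n &
     (forall x : 'I_n, x \in u -> arc n (arc_len k s t a) a x ->
        arc n (arc_len k s t a') a' x) /\
     (arc n (arc_len k s t a) a v -> arc n (arc_len k s t a') a' w)) ->
  two_arcs k s t u -> v \in u -> two_arcs k s t (w |: u)%SET.
Proof.
move=> dom /asboolP[a [b [an bn ab]]] vu.
have [a' an' [Ha Ha']] := dom a an; have [b' bn' [Hb Hb']] := dom b bn.
apply/asboolP; exists a', b'; split=> // x; rewrite mem_valU1 => /orP[/eqP ->|ux].
  have /ab : mem_val u v by rewrite mem_valE.
  by move=> /orP[/Ha'|/Hb'] ->; rewrite ?orbT.
have xn := mem_val_lt ux; have xu : Ordinal xn \in u by rewrite -mem_valE.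
by case/orP: (ab x ux) => [/(Ha _ xu)|/(Hb _ xu)] /= ->; rewrite ?orbT.
Qed.

(* With [K = k + 1], the vertices [1], [2K + 3] and [K + 3] are successively
   dominated by their predecessors. *)
Lemma two_arcs_reduce (k : nat) : 2 <= k -> homotopy_equivalent R
  (realization R (@two_arcs (3 * k.+1 + 2) k.+1 true false))
  (realization R (@two_arcs (3 * k + 2) k true true)).
Proof.
move=> k2; set n := 3 * k.+1 + 2; set m := 3 * k + 2.
have n0 : 0 < n by rewrite /n; clear; lia.
have v1 : 1 < n by rewrite /n; clear; lia.
have v2 : 2 * k.+1 + 3 < n by rewrite /n; clear -k2; lia.
have w2 : 2 * k.+1 + 2 < n by rewrite /n; clear -k2; lia.
have v3 : k.+1 + 3 < n by rewrite /n; clear -k2; lia.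
have w3 : k.+1 + 2 < n by rewrite /n; clear -k2; lia.
pose K0 : pred {set 'I_n} := @two_arcs n k.+1 true false.
pose K1 : pred {set 'I_n} := [pred u | K0 u && (Ordinal v1 \notin u)].
pose K2 : pred {set 'I_n} := [pred u | K1 u && (Ordinal v2 \notin u)].
pose K3 : pred {set 'I_n} := [pred u | K2 u && (Ordinal v3 \notin u)].
have down (K : pred {set 'I_n}) v : down_closed K ->
    down_closed [pred u | K u && (v \notin u)].
  move=> Kd s u su /= /andP[/(Kd _ _ su) ->]; apply: contra.
  exact: (fintype.subsetP su).
have Kd0 : down_closed K0 by exact: two_arcs_down.
have Kd1 : down_closed K1 by exact: down.
have Kd2 : down_closed K2 by exact: down.
have Ke0 : K0 finset.set0 by exact: two_arcs0.
have Ke1 : K1 finset.set0 by rewrite /K1 /= Ke0 finset.in_set0.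
have Ke2 : K2 finset.set0 by rewrite /K2 /= Ke1 finset.in_set0.
have ne (u : {set 'I_n}) (v x : 'I_n) : v \notin u -> x \in u -> x <> v :> nat.
  by move=> vu xu /val_inj xv; rewrite -xv xu in vu.
have s1 : homotopy_equivalent R (realization R K0) (realization R K1).
  apply: (@collapse_vertex _ _ _ (Ordinal n0)) => // u; apply: two_arcs_dominated => a an.
  exists (if a == 1 then 0 else a); first by case: ifP.
  by split=> [x _|]; move: an; rewrite /arc /arc_len /n /=; clear -k2; case: ifP; lia.
(* The arc at 2K + 3 ends at 1, already deleted, so shifting it one step back loses nothing.
   Likewise the arc at K + 3, treated next, ends at 2K + 3. *)
have s2 : homotopy_equivalent R (realization R K1) (realization R K2).
  apply: (@collapse_vertex _ _ _ (Ordinal w2)) => //.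
    by rewrite -val_eqE /=; clear; lia.
  move=> u /andP[K0u u1] vu; apply/andP; split; last first.
    by rewrite !inE negb_or u1 -val_eqE /= andbT; clear; lia.
  apply: two_arcs_dominated K0u vu => a an.
  exists (if a == 2 * k.+1 + 3 then 2 * k.+1 + 2 else a); first by case: ifP.
  split=> [x xu|].
    move: an (ltn_ord x) (ne _ _ _ u1 xu); rewrite /arc /arc_len /n /=.
    by clear -k2; case: ifP; lia.
  move: an; rewrite /arc /arc_len /n /=; clear -k2; case: ifP; lia.
have s3 : homotopy_equivalent R (realization R K2) (realization R K3).
  apply: (@collapse_vertex _ _ _ (Ordinal w3)) => //.
    by rewrite -val_eqE /=; clear; lia.
  move=> u /andP[/andP[K0u u1] u2] vu; apply/andP; split; last first.
    by rewrite !inE negb_or u2 -val_eqE /= andbT; clear; lia.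
  apply/andP; split; last first.
    by rewrite !inE negb_or u1 -val_eqE /= andbT; clear; lia.
  apply: two_arcs_dominated K0u vu => a an.
  exists (if a == k.+1 + 3 then k.+1 + 2 else a); first by case: ifP.
  split=> [x xu|].
    move: an (ltn_ord x) (ne _ _ _ u1 xu) (ne _ _ _ u2 xu).
    rewrite /arc /arc_len /n /=; clear -k2; case: ifP; lia.
  move: an; rewrite /arc /arc_len /n /=; clear -k2; case: ifP; lia.
apply: homotopy_equivalent_trans s1 (homotopy_equivalent_trans s2
  (homotopy_equivalent_trans s3 _)).
apply: homotopy_equivalent_sym.
(* [c] skips the three deleted vertices; [d] is its inverse and gives a deleted vertex the number of
   its successor. *)
pose c x := x + (0 < x) + (k.+1 + 1 < x) + (2 * k.+1 < x).
pose d x := x - (1 < x) - (k.+1 + 3 < x) - (2 * k.+1 + 3 < x).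
have cn (i : 'I_m) : c i < n.
  by have := ltn_ord i; rewrite /c /n /m; clear; lia.
have dm a : a < n -> d a < m by rewrite /d /n /m; clear -k2; lia.
have cd x : x < n -> x <> 1 -> x <> k.+1 + 3 -> x <> 2 * k.+1 + 3 -> c (d x) = x.
  by rewrite /c /d /n; clear -k2; lia.
pose g (i : 'I_m) : 'I_n := Ordinal (cn i).
apply: (@realization_relabel _ _ _ g).
- move=> i j /(congr1 val); rewrite /= /c => ij; apply: val_inj => /=.
  by move: ij; clear; lia.
- move=> u /andP[/andP[/andP[_ u1] u2] u3]; apply/fintype.subsetP => x xu.
  have xE : x = g (Ordinal (dm _ (ltn_ord x))).
    apply: val_inj; rewrite /= cd //.
    + exact: ne u1 xu.
    + exact: ne u3 xu.
    + exact: ne u2 xu.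
  by rewrite xE codom_f.
- move=> u; have gu (v : 'I_n) : (forall i : 'I_m, c i <> v) -> v \notin (g @: u)%SET.
    by move=> cv; apply/finset.imsetP => -[i _ vE]; apply: (cv i); rewrite vE.
  rewrite /K3 /K2 /K1 /= !gu ?andbT.
  (* K + 1 consecutive vertices contain a deleted one unless they start at 2, so most arcs keep at
     most k + 1 vertices. The long arc at 0 and the arc at 2 keep k + 2, and become the long arcs at
     0 and 1. *)
  + apply: two_arcs_imset => a an.
      exists (d a); first exact: dm.
      move=> i; have := ltn_ord i; move: an.
      by rewrite /= /c /d /arc /arc_len /n /m; clear -k2; lia.
    exists (c a); first exact: (cn (Ordinal an)).
    move=> i; have := ltn_ord i; move: an.
    by rewrite /= /c /arc /arc_len /n /m; clear -k2; lia.
  + by move=> i; rewrite /= /c; clear; lia.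
  + by move=> i; rewrite /= /c; clear; lia.
  + by move=> i; rewrite /= /c; clear; lia.
Qed.

(** Without 2, the arcs starting at the other vertices are the triples of neighbours on the cycle 0,
    1, 3, 4, 5, 6, 7, and the arc at 2 keeps only 3 and 4. Two arcs thus cover at most six of the
    seven vertices, and any six can be covered. *)
Lemma two_arcs_base : homotopy_equivalent R
  (realization R (@two_arcs 8 2 true true)) (sphere R 5).
Proof.
pose v : 'I_8 := Ordinal (isT : 2 < 8); pose w : 'I_8 := Ordinal (isT : 1 < 8).
pose K : pred {set 'I_8} := [pred u | two_arcs 2 true true u && (v \notin u)].
apply: (@homotopy_equivalent_trans _ _ _ _ _ (realization R K)).
  apply: (@collapse_vertex _ _ _ w) => //; first exact: two_arcs_down.
    exact: two_arcs0.
  move=> u; apply: two_arcs_dominated => a an.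
  exists (if a == 2 then 1 else a); first by case: ifP.
  by split=> [x _|]; move: an; rewrite /arc /arc_len /=; clear; case: ifP; lia.
apply: homotopy_equivalent_trans (boundary_simplex_sphere R 5).
apply: homotopy_equivalent_sym.
have lE (i : 'I_7) : lift v i = i + (2 <= i) :> nat by rewrite /= /bump addnC.
apply: (@realization_relabel _ _ _ (lift v)); first exact: lift_inj.
- move=> u /andP[_ vu]; apply/fintype.subsetP => x xu.
  have : v != x by apply: contraNneq vu => ->.
  by case/unlift_some => i -> _; rewrite codom_f.
- move=> u; rewrite /K /=.
  have -> : v \notin (lift v @: u)%SET.
    by apply/finset.imsetP => -[i _ /eqP]; rewrite (negbTE (neq_lift _ _)).
  rewrite andbT; apply/asboolP/existsP => [[a [b [an bn ab]]]|[j ju]].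
    apply: contrapT => uT; have full x : x < 8 -> x <> 2 ->
        arc 8 (arc_len 2 true true a) a x || arc 8 (arc_len 2 true true b) b x.
      move=> x8 x2; apply: ab; rewrite (mem_valE _ (Ordinal x8)).
      have : v != Ordinal x8 by apply/eqP => /(congr1 val) /= /esym.
      case/unlift_some => i -> _; apply: imset_f.
      by apply: contrapT => iu; apply: uT; exists i; apply/negP.
    have no_pair : all (fun a => all (fun b => ~~ all (fun x =>
        arc 8 (arc_len 2 true true a) a x || arc 8 (arc_len 2 true true b) b x)
        [:: 0; 1; 3; 4; 5; 6; 7]) (iota 0 8)) (iota 0 8) by [].
    move/allP/(_ a): no_pair; rewrite mem_iota => /(_ an)/allP/(_ b).
    rewrite mem_iota => /(_ bn)/negP; apply; apply/allP => x xs.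
    by apply: full; move: xs; rewrite !inE; clear; lia.
  (* The arcs after the missing vertex [j] and after its third successor. *)
  exists (nth 0 [:: 1; 3; 4; 5; 6; 7; 0] j), (nth 0 [:: 5; 6; 7; 0; 1; 3; 4] j).
  split; [by case: j {ju} => -[|[|[|[|[|[|[|]]]]]]]..|].
  move=> x /mem_val_imset[i iu <-]; rewrite lE.
  have ij : i != j :> nat by apply: contraNneq ju => /val_inj <-.
  have cov : all (fun j => all (fun i => (i == j) ||
      (let a := nth 0 [:: 1; 3; 4; 5; 6; 7; 0] j in
       let b := nth 0 [:: 5; 6; 7; 0; 1; 3; 4] j in
       arc 8 (arc_len 2 true true a) a (i + (2 <= i)) ||
       arc 8 (arc_len 2 true true b) b (i + (2 <= i)))) (iota 0 7)) (iota 0 7) by [].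
  move/allP/(_ (val j)): cov; rewrite mem_iota => /(_ (ltn_ord j))/allP/(_ (val i)).
  by rewrite mem_iota => /(_ (ltn_ord i)); rewrite (negbTE ij).
Qed.

End Reduction.

(** * The cut complex as a complex of two arcs *)

Section CutComplex.
Local Open Scope nat_scope.

Lemma card_le_inj (n m : nat) (T : {set 'I_n}) (f : nat -> nat) :
  (forall x : 'I_n, x \in T -> f x < m) ->
  (forall x y : 'I_n, x \in T -> y \in T -> f x = f y -> x = y :> nat) ->
  #|T| <= m.
Proof.
move=> fm finj; have [->|[x0 x0T]] := finset.set_0Vmem T; first by rewrite cards0.
case: m fm => [|m] fm; first by have := fm _ x0T.
pose F (x : 'I_n) : 'I_m.+1 := inord (f x).
have Finj : {in T &, injective F}.
  move=> x y xT yT /(congr1 (@nat_of_ord _)); rewrite !inordK ?fm//.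
  by move=> /(finj _ _ xT yT)/val_inj.
by rewrite -(card_in_imset Finj) -[leqRHS]card_ord max_card.
Qed.

Section Unfold.
Context (k : nat) (k2 : 2 <= k).
Notation n := (3 * k + 2).
Implicit Types T : {set 'I_n}.

(* Modulo [n], 3(k + 1) = 1 and 3k = -2, so that 3u and 3v are adjacent in the
   squared cycle iff [u - v] is one of [k], [-k], [k + 1], [-(k + 1)]. *)
Definition conflict (u v : nat) : bool :=
  (u + k == v) || (v + k == u) || (u + k.+1 == v) || (v + k.+1 == u)
  || (u + (2 * k + 1) == v) || (v + (2 * k + 1) == u)
  || (u + (2 * k + 2) == v) || (v + (2 * k + 2) == u).

Lemma conflictPn u v : ~~ conflict u v ->
  [/\ u + k <> v, u + k.+1 <> v, u + (2 * k + 1) <> v & u + (2 * k + 2) <> v] /\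
  [/\ v + k <> u, v + k.+1 <> u, v + (2 * k + 1) <> u & v + (2 * k + 2) <> u].
Proof.
rewrite /conflict !negb_or => /andP[/andP[/andP[/andP[/andP[/andP[/andP[]]]]]]].
by do 8 move=> /eqP ?.
Qed.

Definition conflict_free T := forall u v : 'I_n, u \in T -> v \in T -> ~~ conflict u v.

(** Multiplication by 3 modulo n, split by the quotient so as to remain linear. *)
Definition triple_val (u : nat) : nat :=
  if u <= k then 3 * u else if u <= 2 * k + 1 then 3 * u - n else 3 * u - 2 * n.

Lemma triple_lt (u : 'I_n) : triple_val u < n.
Proof. have := ltn_ord u; rewrite /triple_val; clear; repeat case: ifP; lia. Qed.

Definition triple (u : 'I_n) : 'I_n := Ordinal (triple_lt u).

Lemma triple_inj : injective triple.
Proof.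
move=> u v /(congr1 val) /= uv; apply: val_inj => /=.
have := ltn_ord u; have := ltn_ord v; move: uv; rewrite /triple_val; clear.
repeat case: ifP; lia.
Qed.

Lemma eq_modn_wrap x y d : x < n -> y < n -> d <= n ->
  (y == (x + d) %% n) = (x + d == y) || (x + d == y + n).
Proof.
move=> xn yn dn; have [xdn|nxd] := ltnP (x + d) n.
  rewrite modn_small //; move: yn xdn; clear; lia.
rewrite -{1}(subnK nxd) modnDr modn_small; move: (xn) yn dn nxd; clear; lia.
Qed.

Lemma adj_triple (u v : 'I_n) : sqcycle_adj (triple u) (triple v) = conflict u v.
Proof.
have tP (x : 'I_n) : (triple_val x = 3 * x /\ x <= k) \/
    (triple_val x + n = 3 * x /\ k < x <= 2 * k + 1) \/
    (triple_val x + 2 * n = 3 * x /\ 2 * k + 1 < x < n).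
  have := ltn_ord x; rewrite /triple_val; clear; repeat case: ifP; lia.
rewrite /sqcycle_adj !eq_modn_wrap ?triple_lt //=; try by move: k2; clear; lia.
move: (triple_lt u) (triple_lt v) (tP u) (tP v); rewrite /conflict.
move: (triple_val u) (triple_val v) => a b; clear -k2 => an bn.
by move=> [[? ?]|[[? ?]|[? ?]]] [[? ?]|[[? ?]|[? ?]]]; lia.
Qed.

(* In the original labelling, cut the cycle at 0 and at 3i: the vertices left
   free by 0 split into [k - 2] blocks of three consecutive ones, and [f] is the
   number of the block. *)
Lemma gap_count T i : conflict_free T -> mem_val T 0 -> ~~ mem_val T 1 ->
  mem_val T i -> 1 <= i <= k.+1 -> #|T| < k.
Proof.
move=> cT T0 T1 Ti ik.
have c x y : mem_val T x -> mem_val T y -> ~~ conflict x y.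
  by move=> xT yT; have := cT (Ordinal (mem_val_lt xT)) (Ordinal (mem_val_lt yT));
    rewrite -!mem_valE; apply.
have i1 : i != 1 by apply: contraNneq T1 => iE; rewrite iE in Ti.
pose f w := if w == 0 then 0 else if w < k then w - 1 else
  let j := if w < 2 * k + 2 then w - k.+1 else w - (2 * k + 2) in
  if j < i then j else j - 1.
have {}ik : 2 <= i < k.
  have [[i1' i2 _ _] _] := conflictPn (c _ _ T0 Ti).
  by move: ik i1 i1' i2; clear; lia.
have x1 (x : 'I_n) : x \in T -> x <> 1 :> nat.
  by rewrite -mem_valE => xT xE; rewrite xE in xT; rewrite xT in T1.
have fP (x : 'I_n) : x \in T -> f x < k - 1 /\
    (x = 0 :> nat /\ f x = 0 \/ 0 < f x /\ x = f x + 1 :> nat \/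
     f x + 1 < i /\ (x = k.+1 + f x :> nat \/ x = 2 * k + 2 + f x :> nat) \/
     i <= f x + 1 /\ (x = k.+2 + f x :> nat \/ x = 2 * k + 3 + f x :> nat)).
  move=> xT; have xT' := etrans (mem_valE _ _) xT.
  have [[x2 x3 x4 x5] _] := conflictPn (c _ _ T0 xT').
  have [[x6 x7 x8 x9] _] := conflictPn (c _ _ Ti xT').
  move: (ltn_ord x) (x1 x xT) x2 x3 x4 x5 x6 x8 ik; rewrite /f.
  move: (nat_of_ord x); clear => x xn ? ? ? ? ? ? ? ik.
  have [->|x0] := eqVneq x 0; first by lia.
  have [xk|kx] := ltnP x k; first by lia.
  by case: (ltnP x (2 * k + 2)) => h1; case: ifP => h2; lia.
suff : #|T| <= k - 1 by move: k2; clear; lia.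
apply: (@card_le_inj _ _ _ f) => [x /fP[]//|x y xT yT].
have [_] := fP x xT; have [_] := fP y yT; have := conflictPn (cT x y xT yT).
move=> + + + fxy; rewrite -fxy; move: (nat_of_ord x) (nat_of_ord y) (f x).
clear -ik => {}x {}y c [[? ? ? ?] [? ? ? ?]].
by case=> [[? ?]|[[? ?]|[[? [?|?]]|[? [?|?]]]]];
  case=> [[? ?]|[[? ?]|[[? [?|?]]|[? [?|?]]]]]; lia.
Qed.

Definition wrap (x : nat) : nat := if x < n then x else x - n.

Lemma rotate_lt (x w : 'I_n) : wrap (x + w) < n.
Proof. have := ltn_ord x; have := ltn_ord w; rewrite /wrap; clear; case: ifP; lia. Qed.

Definition rotate (x w : 'I_n) : 'I_n := Ordinal (rotate_lt x w).

Lemma rotate_inj x : injective (rotate x).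
Proof.
move=> u v /(congr1 val) /=; have := ltn_ord x; have := ltn_ord u; have := ltn_ord v.
by move=> ? ? ? uv; apply: val_inj => /=; move: uv; rewrite /wrap; do 2 case: ifP; lia.
Qed.

Lemma mem_val_rotate x T w : w < n ->
  mem_val (rotate x @^-1: T)%SET w = mem_val T (wrap (x + w)).
Proof.
move=> wn; rewrite (mem_valE _ (Ordinal wn)) inE -mem_valE.
by [].
Qed.

Lemma conflict_free_rotate x T :
  conflict_free T -> conflict_free (rotate x @^-1: T)%SET.
Proof.
move=> cT u v; rewrite !inE => uT vT; apply: contra (cT _ _ uT vT).
have := ltn_ord x; have := ltn_ord u; have := ltn_ord v.
rewrite /conflict /rotate /wrap /=; clear -k2; do 2 case: ifP; lia.
Qed.

(** [gap_count] after a rotation: each run of [T] is followed by k + 1 vertices outside [T]. Since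
    only 2k + 2 vertices lie outside, two such gaps account for all of them. *)
Lemma gap T x i : conflict_free T -> #|T| = k -> mem_val T x ->
  ~~ mem_val T (wrap x.+1) -> 1 <= i <= k.+1 -> ~~ mem_val T (wrap (x + i)).
Proof.
move=> cT cardT Tx Tx1 ik; have xn := mem_val_lt Tx.
have i_n : i < n by move: ik; clear; lia.
have n1 : 1 < n by clear; lia. have n0 : 0 < n by clear; lia.
pose r := (rotate (Ordinal xn) @^-1: T)%SET.
apply/negP => Ti; suff : #|r| < k.
  by rewrite card_preimset ?cardT ?ltnn//; exact: rotate_inj.
apply: (@gap_count r i) => //.
- exact: conflict_free_rotate.
- by rewrite mem_val_rotate // addn0 /wrap /= xn.
- by rewrite mem_val_rotate // addn1.
- by rewrite mem_val_rotate.
Qed.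

Lemma complement_cover0 T : conflict_free T -> #|T| = k -> mem_val T 0 ->
  ~~ mem_val T 1 ->
  exists2 z, z < n & forall x, x < n -> ~~ mem_val T x -> arc n k 1 x || arc n k z x.
Proof.
move=> cT cardT T0 T1; have n1 : 1 < n by clear; lia.
have g0 i : 1 <= i <= k.+1 -> ~~ mem_val T i.
  move=> ik; have := gap (x := 0) (i := i) cT cardT T0 _ ik; rewrite /wrap n1 T1 add0n.
  by have -> : i < n; [move: ik; clear; lia|apply].
have c x : mem_val T x -> ~~ conflict 0 x.
  by move=> xT; have := cT (Ordinal (mem_val_lt T0)) (Ordinal (mem_val_lt xT));
    rewrite -!mem_valE; apply.
(* The second gap follows a run ending at some y, and it stops before 0, which is in [T]. If no run
   ends between k + 2 and 3k, a vertex of [T] in the range k + 2 to 2k + 2 would force 2k + 2 into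
   [T], in conflict with 0. *)
have [z zk zT] : exists2 z, k + 2 <= z <= 2 * k + 1 &
    forall w, z <= w <= z + k -> ~~ mem_val T w.
  have [[y [yk Ty Ty1]]|up] := pselect (exists y,
      [/\ k + 2 <= y <= 3 * k, mem_val T y & ~~ mem_val T y.+1]).
    have yn : y.+1 < n by move: yk; clear; lia.
    have gy i : 1 <= i <= k.+1 -> ~~ mem_val T (wrap (y + i)).
      by apply: gap => //; rewrite /wrap yn.
    have yk1 : y + k.+1 < n.
      rewrite ltnNge; apply/negP => ny; have := gy (n - y).
      have -> : wrap (y + (n - y)) = 0.
        by rewrite /wrap subnKC ?ltnn ?subnn//; move: yn; clear; lia.
      by rewrite T0 => /(_ _)/negP; apply=> //; move: yn ny; clear; lia.
    exists y.+1; first by move: yk yk1; clear; lia.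
    move=> w wy; have := gy (w - y); have -> : wrap (y + (w - y)) = w.
      by rewrite /wrap subnKC; [case: ifP|]; move: wy yk1; clear; lia.
    by apply; move: wy; clear; lia.
  exists (k + 2); first by move: k2; clear; lia.
  move=> w wk; apply/negP => Tw.
  have step y : k + 2 <= y <= 3 * k -> mem_val T y -> mem_val T y.+1.
    by move=> yk Ty; apply: contrapT => /negP Ty1; apply: up; exists y.
  have : mem_val T (2 * k + 2).
    have -> : 2 * k + 2 = w + (2 * k + 2 - w) by move: wk; clear; lia.
    have : w + (2 * k + 2 - w) <= 2 * k + 2 by move: wk; clear; lia.
    elim: (2 * k + 2 - w) => [|j IH] jk; first by rewrite addn0.
    rewrite (addnS w); apply: step; last by apply: IH; move: jk; clear; lia.
    by move: jk wk k2; clear; lia.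
  by move=> /c; rewrite /conflict; clear; lia.
exists z; first by move: zk; clear; lia.
move=> x xn xT; apply: contrapT => /negP; rewrite negb_or => /andP[x1 xz].
suff : #|T| <= k - 1 by rewrite cardT; move: k2; clear; lia.
(* [f] numbers the vertices other than x outside both gaps; there are 3k + 2 - 2(k + 1) - 1 = k - 1
   of them. *)
pose f w := w - (if k.+1 < w then k.+1 else 0)
  - (if z + k < w then k.+1 else 0) - (x < w).
have wP (w : 'I_n) : w \in T ->
    [/\ ~~ (1 <= w <= k.+1), ~~ (z <= w <= z + k) & w != x :> nat].
  rewrite -mem_valE => wT; split; first by apply/negP => /g0; rewrite wT.
    by apply/negP => /zT; rewrite wT.
  by apply: contraNneq xT => <-.
have x0 : x <> 0 by move=> x0; rewrite x0 T0 in xT.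
apply: (@card_le_inj _ _ _ f) => [w /wP[]|w w' /wP[h1 h2 h3] /wP[]].
  move: zk x0 x1 xz xn (ltn_ord w); rewrite /arc /f; clear -k2.
  by do 2 case: ifP; lia.
move: zk x0 x1 xz xn (ltn_ord w) (ltn_ord w') h1 h2 h3; rewrite /arc /f; clear -k2.
by do 4 case: ifP; lia.
Qed.

Lemma complement_cover T : conflict_free T -> #|T| = k ->
  exists a b, [/\ a < n, b < n &
    forall x, x < n -> ~~ mem_val T x -> arc n k a x || arc n k b x].
Proof.
move=> cT cardT; have n1 : 1 < n by clear; lia. have n0 : 0 < n by clear; lia.
have [x Tx Tx1] : exists2 x, mem_val T x & ~~ mem_val T (wrap x.+1).
  apply: contrapT => nx.
  have step x : mem_val T x -> mem_val T (wrap x.+1).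
    by move=> Tx; apply: contrapT => /negP Tx1; apply: nx; exists x.
  have [T0|[x xT]] := finset.set_0Vmem T.
    by move: cardT k2; rewrite T0 cards0 => <-.
  have Tj j : j < n -> mem_val T (wrap (x + j)).
    elim: j => [|j IH] jn; first by rewrite addn0 /wrap ltn_ord mem_valE.
    have := step _ (IH (ltnW jn)).
    have -> // : wrap (wrap (x + j)).+1 = wrap (x + j.+1).
    move: (ltn_ord x) jn; rewrite /wrap; clear; do 3 case: ifP; lia.
  have kn : k < n by clear; lia.
  have := cT x (rotate x (Ordinal kn)) xT.
  rewrite -mem_valE /= Tj // => /(_ isT); rewrite /conflict /wrap.
  by have := ltn_ord x; clear -k2; case: ifP; lia.
have xn := mem_val_lt Tx.
pose r := (rotate (Ordinal xn) @^-1: T)%SET.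
have [||||z zn rz] := @complement_cover0 r.
- exact: conflict_free_rotate.
- by rewrite card_preimset //; exact: rotate_inj.
- by rewrite mem_val_rotate // addn0 /wrap /= xn.
- by rewrite mem_val_rotate // addn1.
exists (wrap (x + 1)), (wrap (x + z)); split.
- by rewrite /wrap; move: (xn); clear; case: ifP; lia.
- by rewrite /wrap; move: (xn) zn; clear; case: ifP; lia.
move=> y yn Ty; pose w := if x <= y then y - x else y + n - x.
have wn : w < n by rewrite /w; move: (xn) yn; clear; case: ifP; lia.
have := rz w wn; rewrite mem_val_rotate //=.
have -> : wrap (x + w) = y.
  by rewrite /wrap /w; move: (xn) yn; clear; do 2 case: ifP; lia.
move=> /(_ Ty); move: (xn) yn zn; rewrite /arc /w /wrap; clear -k2.
by do 3 case: ifP; lia.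
Qed.

(** If the arcs overlap, the second is moved to just after or just before the first, losing only
    vertices that the first one covers. The bounds on [d] express disjointness. *)
Lemma arc_cover_disjoint p : arc_cover n k false false p ->
  exists a d, [/\ a < n, k.+1 <= d <= 2 * k + 1 &
    forall x, x < n -> p x -> arc n k a x || arc n k (wrap (a + d)) x].
Proof.
move=> [a [b [an bn ab]]].
pose d := if a <= b then b - a else b + n - a.
exists a, (if d <= k then k.+1 else if d <= 2 * k + 1 then d else 2 * k + 1); split=> //.
  by move: k2; clear; repeat case: ifP; lia.
move=> x xn /ab; rewrite /arc_len /= !addn0; move: an bn xn; clear -k2.
by rewrite /arc /wrap {}/d; repeat case: ifP; lia.
Qed.

Lemma total_cut_face_triple (u : {set 'I_n}) :
  total_cut_face (@sqcycle_adj n) k (triple @: u)%SET = two_arcs k false false u.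
Proof.
apply/existsP/asboolP => [[S /and3P[/forallP indS /eqP cardS /fintype.subsetP Su]]|].
  pose T := (triple @^-1: S)%SET.
  have cT : conflict_free T.
    move=> x y; rewrite !inE => xS yS.
    have [->|xy] := eqVneq x y; first by rewrite /conflict; move: k2; clear; lia.
    have /implyP/(_ xS)/forallP/(_ (triple y))/implyP/(_ yS) := indS (triple x).
    by rewrite (inj_eq triple_inj) xy adj_triple.
  have [|a [b [an bn ab]]] := complement_cover cT.
    by rewrite card_preimset //; exact: triple_inj.
  exists a, b; split=> // x ux; have xn := mem_val_lt ux.
  rewrite /arc_len /= !addn0; apply: ab => //.
  rewrite (mem_valE _ (Ordinal xn)) inE; apply/negP => /Su.
  by rewrite inE imset_f // -mem_valE.
move=> /arc_cover_disjoint[a [d [an dk ad]]].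
(* The k vertices outside the two arcs, counted from a. Two of them differ by less than k on the
   same side of the second arc, and by k + 2 to 2k across it, so they never conflict. *)
pose pos i := wrap (a + (k.+1 + i + (if i + k.+1 < d then 0 else k.+1))).
have posn (i : 'I_k) : pos i < n.
  move: (ltn_ord i) an dk; rewrite /pos /wrap; clear.
  by case: (ltnP (i + k.+1) d) => ?; case: ifP; lia.
pose f (i : 'I_k) := triple (Ordinal (posn i)).
have finj : injective f.
  move=> i j /triple_inj /(congr1 val) /= ij; apply: val_inj => /=.
  move: (ltn_ord i) (ltn_ord j) an dk ij; rewrite /pos /wrap; clear.
  by case: (ltnP (i + k.+1) d) => ?; case: (ltnP (j + k.+1) d) => ?;
    do 2 case: ifP => ?; lia.
exists (f @: 'I_k)%SET; apply/and3P; split.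
- apply/forallP => x; apply/implyP => /finset.imsetP[i _ ->].
  apply/forallP => y; apply/implyP => /finset.imsetP[j _ ->]; apply/implyP => _.
  rewrite adj_triple /conflict /=.
  move: (ltn_ord i) (ltn_ord j) an dk; rewrite /pos /wrap; clear.
  by case: (ltnP (i + k.+1) d) => ?; case: (ltnP (j + k.+1) d) => ?;
    do 2 case: ifP => ?; lia.
- by rewrite card_imset // card_ord.
- apply/fintype.subsetP => x /finset.imsetP[i _ ->]; rewrite inE.
  apply/finset.imsetP => -[y yu /triple_inj/(congr1 val) /= iy].
  have := ad y (ltn_ord y); rewrite mem_valE yu => /(_ isT).
  move: (ltn_ord i) an dk iy; rewrite /arc /pos /wrap; clear.
  by case: (ltnP (i + k.+1) d) => ?; do 2 case: ifP => ?; lia.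
Qed.

End Unfold.
End CutComplex.

(** * Induction on k and the theorem *)

Lemma two_arcs_sphere (R : realType) (k : nat) : (2 <= k)%N ->
  homotopy_equivalent R (realization R (@two_arcs (3 * k + 2) k true true))
    (sphere R 5).
Proof.
elim: k => // k IHk; rewrite leq_eqVlt => /predU1P[<-|k2].
  exact: two_arcs_base.
apply: homotopy_equivalent_trans (IHk k2).
apply: homotopy_equivalent_trans (two_arcs_reduce k2).
(* Here [t] is true: the arc at 1 stays long, and the rotation brings it to 0. *)
apply: homotopy_equivalent_trans (raise_arc _ _) _ => //.
apply: homotopy_equivalent_sym; apply: two_arcs_rotate; clear; lia.
Qed.

Theorem theorem4p3 (R : realType) (k : nat) (hk : (3 <= k)%N) :
  homotopy_equivalent R
    (realization R (total_cut_face (@sqcycle_adj (3 * k + 2)) k))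
    (sphere R 5).
Proof.
have k2 : (2 <= k)%N by exact: ltnW.
apply: homotopy_equivalent_trans (_ : homotopy_equivalent R _
    (realization R (@two_arcs (3 * k + 2) k false false))) _.
  apply: homotopy_equivalent_sym.
  apply: (@realization_relabel _ _ _ (@triple k)).
  - exact: triple_inj.
  - move=> s _; apply/fintype.subsetP => x _.
    by rewrite (inj_card_onto (@triple_inj k)).
  - exact: total_cut_face_triple.
apply: homotopy_equivalent_trans
  (homotopy_equivalent_sym (@raise_arc R k false hk)) _.
case: k hk k2 => // k hk _.
exact: homotopy_equivalent_trans (two_arcs_reduce hk) (two_arcs_sphere R hk).
Qed.
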